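(* For every integer $s\ge4$, the quotient $\mathfrak{Im}(\mathcal M(-s))/\mathcal S(s)$ is a realization of the quotient $\mathcal{RI}\Omega^1(-s)/PSL(2,\mathbb C)$; that is, $\mathcal{RI}\Omega^1(-s)/PSL(2,\mathbb C)$ is homeomorphic to $\mathfrak{Im}(\mathcal M(-s))/\mathcal S(s)$, where $\mathcal S(s)$ acts by the action described in the context.
   Context: $\Omega^1(-1^s)$ denotes the set of rational 1-forms on the Riemann sphere $\widehat{\mathbb C}$ having exactly $s$ poles, all simple (zeros are arbitrary). It is a $(2s-1)$-dimensional complex manifold via the bijection sending $\omega$ to the class $\langle r_1,\dots,r_s;p_1,\dots,p_s\rangle$ of its residues $r_\iota$ at its poles $p_\iota$ in $\bigl(H_s\times(\widehat{\mathbb C}^s\setminus\Delta)\bigr)/\mathcal S(s)$, where $H_s=\{(r_1,\dots,r_s)\in(\mathbb C^* )^s : \sum r_\iota=0\}$, $\widehat{\mathbb C}^s\setminus\Delta$ is the set of $s$-tuples of pairwise distinct points of $\widehat{\mathbb C}$, and the symmetric group $\mathcal S(s)$ permutes the $r_\iota$ and the $p_\iota$ simultaneously. $\mathcal{RI}\Omega^1(-s)\subset\Omega^1(-1^s)$ is the real analytic submanifold of isochronous forms, i.e. those all of whose residues are purely imaginary. $PSL(2,\mathbb C)$ acts by push-forward, $T_*\langle r_1,\dots,r_s;p_1,\dots,p_s\rangle=\langle r_1,\dots,r_s;T(p_1),\dots,T(p_s)\rangle$. Quotients carry the quotient topology. Let $\mathbb A_s=\{(r_1,\dots,r_{s-1})\in\mathbb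 C^{s-1}: r_1+\dots+r_{s-1}\neq0,\ r_\iota\ne0 \text{ for } \iota=1,\dots,s-1\}$, $\mathfrak{Im}(\mathbb A_s)=\{(ir_1,\dots,ir_{s-1})\in\mathbb A_s: r_\iota\in\mathbb R^*,\ \iota=1,\dots,s-1\}$, let $[\mathbb C^*\setminus\{1\}]^{s-3}\setminus\Delta=\{(p_4,\dots,p_s)\in[\mathbb C^*\setminus\{1\}]^{s-3}: p_\iota\neq p_\kappa\text{ for }\iota\ne\kappa\}$, and $$\mathfrak{Im}(\mathcal M(-s))=\mathfrak{Im}(\mathbb A_s)\times\bigl([\mathbb C^*\setminus\{1\}]^{s-3}\setminus\Delta\bigr).$$ A point $(\rho_1,\dots,\rho_{s-1},p_4,\dots,p_s)$ represents the 1-form $\langle \rho_1,\dots,\rho_s;0,\infty,1,p_4,\dots,p_s\rangle$ with $\rho_s=-(\rho_1+\dots+\rho_{s-1})$. The action of $\mathcal S(s)$ is $\sigma\cdot(\rho_1,\dots,\rho_{s-1},p_4,\dots,p_s)=\bigl(A_\sigma(\rho_1,\dots,\rho_{s-1})^{T},\,f_\sigma(p_4,\dots,p_s)\bigr)$, where $\sigma\mapsto(A_\sigma,f_\sigma)\in GL_{s-1}(\mathbb Z)\times Bir(\widehat{\mathbb C}^{s-3})$ is the representation (with $Bir$ the group of birational maps) determined on the Coxeter generators $\sigma_j=(j\ \ j+1)$, $j=1,\dots,s-1$, by $(A_j,f_j)$ with: for $j=1,\dots,s-2$, $A_j$ is the identity matrix with rows $j$ and $j+1$ exchanged; $A_{s-1}$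 is the identity matrix with row $s-1$ replaced by $(-1,\dots,-1)$; and $$f_1=\Bigl(\tfrac1{z_4},\dots,\tfrac1{z_s}\Bigr),\quad f_2=\Bigl(\tfrac{z_4}{z_4-1},\dots,\tfrac{z_s}{z_s-1}\Bigr),\quad f_3=\Bigl(\tfrac1{z_4},\tfrac{z_5}{z_4},\dots,\tfrac{z_s}{z_4}\Bigr),$$ $$f_j=(z_{\sigma_j(4)},\dots,z_{\sigma_j(s)})\quad\text{for } j=4,\dots,s-1.$$ *)

(* Defs.v *)
From HB Require Import structures.
From mathcomp Require Import all_boot all_order all_algebra all_fingroup.
From mathcomp Require Import zify ring.
From mathcomp Require Import complex.
From mathcomp Require Import all_classical all_reals all_analysis.

Set Implicit Arguments.
Unset Strict Implicit.
Unset Printing Implicit Defensive.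

Import Order.TTheory GRing.Theory Num.Theory.
Import numFieldNormedType.Exports.

Local Open Scope classical_set_scope.
Local Open Scope ring_scope.
Local Open Scope quotient_scope.

Definition homeomorphic (X Y : topologicalType) : Prop :=
  exists (f : X -> Y) (g : Y -> X),
    [/\ continuous f, continuous g, cancel f g & cancel g f].

(* Everything below is used with C := R[i], R : realType.  C carries the
   topology of its norm. *)

Section RiemannSphere.
Variable C : numClosedFieldType.

(* [Some z] is the finite point z, [None] is the point at infinity. *)
Definition sphere := one_point_compactification C.
HB.instance Definition _ := Topological.on sphere.
HB.instance Definition _ := Pointed.on sphere.

Definition moebius (M : 'M[C]_2) (p : sphere) : sphere :=
  match p with
  | Some z => if M 1 0 * z + M 1 1 == 0 then None
              else Some ((M 0 0 * z + M 0 1) / (M 1 0 * z + M 1 1))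
  | None => if M 1 0 == 0 then None else Some (M 0 0 / M 1 0)
  end.

(* PSL(2,C), as a group of transformations of the sphere. *)
Definition PSL2 : set (sphere -> sphere) :=
  [set T | exists2 M : 'M[C]_2, \det M = 1 & T = moebius M].

Lemma PSL2_id : PSL2 id.
Proof.
exists 1%:M; first by rewrite det1.
apply: funext => -[z|] /=; rewrite !mxE /=.
  by rewrite mul0r add0r oner_eq0 mul1r addr0 divr1.
by rewrite eqxx.
Qed.

Lemma det_mx2 (M : 'M[C]_2) : \det M = M 0 0 * M 1 1 - M 0 1 * M 1 0.
Proof.
rewrite (expand_det_row _ 0) big_ord_recl big_ord1 /cofactor !det_mx11 !mxE /=.
have -> : lift 0 0 = 1 :> 'I_2 by apply: val_inj.
have -> : lift 1 0 = 0 :> 'I_2 by apply: val_inj.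
by rewrite !expr0 expr1; ring.
Qed.

Lemma moebiusM (M N : 'M[C]_2) : \det M = 1 -> \det N = 1 ->
  moebius (M *m N) = moebius M \o moebius N.
Proof.
rewrite !det_mx2 => dM dN.
have E i j : (M *m N) i j = M i 0 * N 0 j + M i 1 * N 1 j.
  rewrite mxE big_ord_recl big_ord1.
  by have -> : lift ord0 ord0 = 1 :> 'I_2 by apply: val_inj.
apply: funext => p; rewrite /moebius /= !E.
move: (M 0 0) (M 0 1) (M 1 0) (M 1 1) (N 0 0) (N 0 1) (N 1 0) (N 1 1) dM dN.
move=> a b c d a' b' c' d' dM dN {M N E}.
have key (x y : C) : (a * x + b * y) * d - (c * x + d * y) * b = x.
  by rewrite -[RHS]mul1r -dM; ring.
have key' (x y : C) : (c * x + d * y) * a - (a * x + b * y) * c = y.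
  by rewrite -[RHS]mul1r -dM; ring.
case: p => [z|] /=.
  set u := a' * z + b'; set v := c' * z + d'.
  have -> : (c * a' + d * c') * z + (c * b' + d * d') = c * u + d * v.
    by rewrite /u /v; ring.
  have -> : (a * a' + b * c') * z + (a * b' + b * d') = a * u + b * v.
    by rewrite /u /v; ring.
  have uv : v = 0 -> u != 0.
    move=> v0; apply/eqP => u0.
    have : (a' * d' - b' * c') = a' * v - c' * u by rewrite /u /v; ring.
    by rewrite u0 v0 dN !mulr0 subrr => /eqP; rewrite oner_eq0.
  case: (eqVneq v 0) => [v0|v0] /=.
    move: (uv v0) => u0; rewrite v0 !mulr0 !addr0 mulf_eq0 (negbTE u0) orbF.
    by case: eqVneq => // c0; congr Some; field; rewrite c0 u0.
  have -> : c * (u / v) + d = (c * u + d * v) / v by field.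
  rewrite mulf_eq0 invr_eq0 (negbTE v0) orbF; case: eqVneq => // e.
  by congr Some; field; rewrite e v0.
case: (eqVneq c' 0) => [c0|c0] /=.
  move: dN; rewrite c0 !mulr0 !addr0 subr0 => dN.
  have a0 : a' != 0.
    by apply/eqP => a0; move: dN => /eqP; rewrite a0 mul0r eq_sym oner_eq0.
  rewrite mulf_eq0 (negbTE a0) orbF.
  by case: eqVneq => // cn0; congr Some; field; rewrite cn0 a0.
have -> : c * (a' / c') + d = (c * a' + d * c') / c' by field.
rewrite mulf_eq0 invr_eq0 (negbTE c0) orbF; case: eqVneq => // e.
by congr Some; field; rewrite e c0.
Qed.

Lemma PSL2_comp (T U : sphere -> sphere) : PSL2 T -> PSL2 U -> PSL2 (T \o U).
Proof.
move=> [M dM ->] [N dN ->]; exists (M *m N); last by rewrite moebiusM.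
by rewrite det_mulmx dM dN mulr1.
Qed.

Lemma PSL2_inv (T : sphere -> sphere) : PSL2 T ->
  exists2 U, PSL2 U & cancel T U /\ cancel U T.
Proof.
move=> [M dM ->].
have uM : M \in unitmx by rewrite unitmxE dM unitr1.
have dV : \det (invmx M) = 1 by rewrite det_inv dM invr1.
have mob1 : moebius 1%:M = id.
  apply: funext => -[z|] /=; rewrite !mxE /=; last by rewrite eqxx.
  by rewrite mul0r add0r oner_eq0 mul1r addr0 divr1.
exists (moebius (invmx M)); first by exists (invmx M).
by split=> p; [have := moebiusM dV dM; rewrite mulVmx //|
  have := moebiusM dM dV; rewrite mulmxV //]; rewrite mob1 => /(congr1 (@^~ p)).
Qed.

End RiemannSphere.

Section FieldIdentities.
Variable F : fieldType.
Implicit Types c x y q s w h : F.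

Fact frac_aux1 c x y : x != 0 -> y != 0 -> c * y^-1 - c * x^-1 = c * (x - y) / (y * x).
Proof. by move=> x0 y0; field; rewrite x0 y0. Qed.

Fact frac_aux2 w h s c x : w - h + s * x = w + c * x - (h - (s - c) * x).
Proof. by ring. Qed.

Fact frac_aux3 q s x : x != 0 -> (q * x + s) / x = q + s * x^-1.
Proof. by move=> x0; field. Qed.

End FieldIdentities.

Section RationalForms.
Variable C : numClosedFieldType.
Local Notation sphere := (sphere C).
Local Notation "x %:F" := (@FracField.tofrac {poly C} x).

(* The rational 1-form f(z) dz is encoded by the rational function f. *)
Local Notation rational_form := {fraction {poly C}}.
Implicit Types (w : rational_form) (p : sphere) (r : C).

(* At infinity, in the coordinate 1/z, the form (u/v) dz is holomorphic iff
   z^2 (u/v)(z) is bounded near infinity, i.e. deg u + 2 <= deg v. *)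
Definition holomorphic_at w p : Prop :=
  match p with
  | Some a => exists u v : {poly C}, v.[a] != 0 /\ w = u%:F / v%:F
  | None => exists u v : {poly C},
      (size u + 2 <= size v)%N /\ w = u%:F / v%:F
  end.

Arguments holomorphic_at : simpl never.

(* dx/x for the local coordinate x at p: x = z - a if p = a, and x = 1/z if p
   is infinity, in which case dx/x = - dz/z. *)
Definition dlog p : rational_form :=
  match p with
  | Some a => (('X - a%:P)%:F)^-1
  | None => - ('X%:F)^-1
  end.

Definition simple_pole w p r : Prop :=
  r != 0 /\ holomorphic_at (w - (r%:P)%:F * dlog p) p.

Definition Omega1_set (s : nat) : set rational_form :=
  [set w | exists p : 'I_s -> sphere,
     [/\ injective p, forall i, exists r, simple_pole w (p i) r &
         forall q, (forall i, p i <> q) -> holomorphic_at w q]].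

(* The pairs (r, p) of H_s x (sphere^s minus the diagonals). *)
Definition residue_pole_set (s : nat) :
    set ('cV[C]_s * {ptws 'I_s -> sphere}) :=
  [set x : 'cV[C]_s * {ptws 'I_s -> sphere} |
     [/\ \sum_i x.1 i 0 = 0, forall i, x.1 i 0 != 0 & injective x.2]].

Arguments Omega1_set : clear implicits.
Arguments residue_pole_set : clear implicits.

(* w = < r_1, ..., r_s ; p_1, ..., p_s > *)
Definition has_residues (s : nat) w
    (x : 'cV[C]_s * {ptws 'I_s -> sphere}) : Prop :=
  [/\ injective x.2, forall i, simple_pole w (x.2 i) (x.1 i 0) &
      forall q, (forall i, x.2 i <> q) -> holomorphic_at w q].

Lemma frac_eqE (u v u' v' : {poly C}) : v != 0 -> v' != 0 ->
  u%:F / v%:F = u'%:F / v'%:F -> u * v' = u' * v.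
Proof.
rewrite -[v == 0]tofrac_eq0 -[v' == 0]tofrac_eq0 => v0 v'0 e.
apply/eqP; rewrite -tofrac_eq !tofracM.
by rewrite -(eqr_div _ _ v0 v'0) e.
Qed.

Lemma frac_addE (u v u' v' : {poly C}) : v != 0 -> v' != 0 ->
  u%:F / v%:F + u'%:F / v'%:F = (u * v' + u' * v)%:F / (v * v')%:F.
Proof.
rewrite -[v == 0]tofrac_eq0 -[v' == 0]tofrac_eq0 => v0 v'0.
by rewrite (addf_div _ _ v0 v'0) tofracD !tofracM.
Qed.

Lemma holomorphic_at0 p : holomorphic_at 0 p.
Proof.
case: p => [a|]; first by exists 0, 1; rewrite hornerC oner_eq0 tofrac0 mul0r.
by exists 0, 'X; rewrite size_poly0 size_polyX tofrac0 mul0r.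
Qed.

Lemma holomorphic_atD w w' p :
  holomorphic_at w p -> holomorphic_at w' p -> holomorphic_at (w + w') p.
Proof.
case: p => [a|] [u [v [hv ->]]] [u' [v' [hv' ->]]].
  exists (u * v' + u' * v), (v * v'); split; first by rewrite hornerM mulf_neq0.
  by rewrite frac_addE //; [apply: contraNneq hv|apply: contraNneq hv'] => ->;
    rewrite horner0.
have v0 : v != 0 by rewrite -size_poly_gt0 (leq_trans _ hv) // addn2.
have v'0 : v' != 0 by rewrite -size_poly_gt0 (leq_trans _ hv') // addn2.
exists (u * v' + u' * v), (v * v'); split; last by rewrite frac_addE.
rewrite size_mul //; have h1 := size_polyMleq u v'; have h2 := size_polyMleq u' v.
have h3 := size_polyD (u * v') (u' * v).
move: hv hv' h1 h2 h3; move: (size _) (size _) (size _) (size _) (size _) (size _) (size _) => a b c d e f g. lia.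
Qed.

Lemma holomorphic_atN w p : holomorphic_at w p -> holomorphic_at (- w) p.
Proof.
case: p => [a|] [u [v [hv ->]]]; exists (- u), v;
  by rewrite ?size_polyN tofracN mulNr.
Qed.

Lemma holomorphic_atB w w' p :
  holomorphic_at w p -> holomorphic_at w' p -> holomorphic_at (w - w') p.
Proof. by move=> hw hw'; apply/holomorphic_atD/holomorphic_atN. Qed.

Lemma holomorphic_at_dlog r p : holomorphic_at ((r%:P)%:F * dlog p) p -> r = 0.
Proof.
case: p => [a|] /= [u [v [hv]]] e.
  have v0 : v != 0 by apply: contraNneq hv => ->; rewrite horner0.
  have X0 : 'X - a%:P != 0 by rewrite polyXsubC_eq0.
  have := frac_eqE X0 v0 e.
  move/(congr1 (fun q : {poly C} => q.[a])).
  rewrite !hornerM !hornerE subrr mulr0 => /eqP.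
  by rewrite mulf_eq0 (negbTE hv) orbF => /eqP.
have v0' : v != 0 by rewrite -size_poly_gt0 (leq_trans _ hv) // addn2.
have X0 : 'X != 0 :> {poly C} by rewrite polyX_eq0.
have {}e : ((- r)%:P)%:F / 'X%:F = u%:F / v%:F.
  by rewrite -e polyCN tofracN mulrN mulNr.
have /(congr1 (fun q : {poly C} => size q)) e' := frac_eqE X0 v0' e.
case: (eqVneq r 0) => // r0; move: e'.
rewrite size_Cmul ?oppr_eq0 //; have := size_polyMleq u 'X.
rewrite size_polyX; move: hv; move: (size _) (size _) (size _) => m n k; lia.
Qed.

Lemma simple_pole_inj w p r r' : simple_pole w p r -> simple_pole w p r' -> r = r'.
Proof.
move=> [_ h] [_ h']; have := holomorphic_atB h' h.
have -> : w - (r'%:P)%:F * dlog p - (w - (r%:P)%:F * dlog p) =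
          ((r - r')%:P)%:F * dlog p by rewrite polyCB tofracB mulrBl opprB addrC addrA addrNK.
by move/holomorphic_at_dlog/eqP; rewrite subr_eq0 => /eqP.
Qed.

Lemma simple_pole_Nholomorphic w p r : simple_pole w p r -> ~ holomorphic_at w p.
Proof.
move=> [r0 h] h'; have := holomorphic_atB h' h; rewrite opprB addrC subrK.
by move/holomorphic_at_dlog/eqP; rewrite (negbTE r0).
Qed.

Lemma entire_form_poly w :
  (forall a, holomorphic_at w (Some a)) -> exists q : {poly C}, w = q%:F.
Proof.
move=> hol; have [u0 [v0 [v00 ew]]] := hol 0.
have {}v00 : v0 != 0 by apply: contraNneq v00 => ->; rewrite horner0.
pose g := gcdp u0 v0.
have g0 : g != 0 by rewrite gcdp_eq0 negb_and v00 orbT.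
pose u := u0 %/ g; pose v := v0 %/ g.
have eu : u0 = u * g by rewrite divpK // dvdp_gcdl.
have ev : v0 = v * g by rewrite divpK // dvdp_gcdr.
have vn0 : v != 0 by apply: contraNneq v00 => v0'; rewrite ev v0' mul0r.
have cop : coprimep u v by rewrite coprimep_div_gcd // v00 orbT.
have {}ew : w = u%:F / v%:F.
  by rewrite ew eu ev !tofracM -mulf_div divff ?mulr1 // tofrac_eq0.
have : size v == 1.
  apply/negPn/negP => /closed_rootP [a ra].
  have [u' [v' [v'a]]] := hol a; rewrite ew => e.
  have v'0 : v' != 0 by apply: contraNneq v'a => ->; rewrite horner0.
  move/(frac_eqE vn0 v'0): e => /(congr1 (fun q : {poly C} => q.[a])).
  rewrite !hornerM (rootP ra) mulr0 => /eqP; rewrite mulf_eq0 (negbTE v'a) orbF.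
  apply/negP; apply: (coprimep_root _ ra).
  by rewrite coprimep_sym.
move/size_poly1P => [c c0 ec]; exists (c^-1 *: u).
rewrite ew ec -mul_polyC tofracM.
have cF : (c%:P)%:F != 0 :> rational_form by rewrite tofrac_eq0 polyC_eq0.
apply: (mulIf cF); rewrite mulfVK // mulrAC -tofracM -polyCM mulVf //.
by rewrite polyC1 tofrac1 mul1r.
Qed.

Lemma residue_sum (s : nat) w (x : 'cV[C]_s * {ptws 'I_s -> sphere}) :
  has_residues w x -> \sum_i x.1 i 0 = 0.
Proof.
case: x => r p [/= injp pole hol].
pose c (t : C) : rational_form := (t%:P)%:F.
have cD : {morph c : a b / a + b} by move=> a b; rewrite /c polyCD tofracD.
have c0 : c 0 = 0 by rewrite /c tofrac0.
pose iX : rational_form := ('X%:F)^-1.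
pose fin i : rational_form := if p i is Some a then dlog (Some a) else 0.
pose rinf i : C := if p i is Some a then 0 else r i 0.
pose h := \sum_i c (r i 0) * fin i.
have hol_sum q (F : 'I_s -> rational_form) (P : pred 'I_s) :
    (forall i, P i -> holomorphic_at (F i) q) ->
    holomorphic_at (\sum_(i | P i) F i) q.
  move=> H; apply: (big_ind (fun t => holomorphic_at t q)) => //.
    exact: holomorphic_at0.
  by move=> t t'; apply: holomorphic_atD.
have fin_hol a i : p i != Some a -> holomorphic_at (c (r i 0) * fin i) (Some a).
  rewrite /fin; case: (p i) => [b|] ne; last first.
    by rewrite mulr0; apply: holomorphic_at0.
  exists (r i 0)%:P, ('X - b%:P); split=> //.
  rewrite !hornerE subr_eq0; apply: contraNneq ne => ->; exact: eqxx.
have [q eq] : exists q : {poly C}, w - h = q%:F.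
  apply: entire_form_poly => a.
  case: (pickP (fun i => p i == Some a)) => [i /eqP pi|no].
    rewrite /h (bigD1 i) //= opprD addrA. apply: holomorphic_atB.
      by have := (pole i).2; rewrite pi /fin pi.
    apply: hol_sum => j ji; apply: fin_hol.
    by apply: contraNneq ji => pj; apply/eqP/injp; rewrite pj pi.
  apply: holomorphic_atB; last by apply: hol_sum => j _; apply: fin_hol; rewrite no.
  by apply: hol => i e; have := no i; rewrite e eqxx.
have X0 : 'X%:F != 0 :> rational_form by rewrite tofrac_eq0 polyX_eq0.
have winf : holomorphic_at (w + c (\sum_i rinf i) * iX) None.
  case: (pickP (fun i => p i == None)) => [i /eqP pi|no].
    have -> : \sum_i rinf i = r i 0.
      rewrite (bigD1 i) //= big1 ?addr0; first by rewrite /rinf pi.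
      move=> j ji; rewrite /rinf; case E: (p j) => [//|].
      by case/eqP: ji; apply: injp; rewrite E pi.
    by have := (pole i).2; rewrite pi /= mulrN opprK.
  rewrite big1; last first.
    by move=> i _; rewrite /rinf; have := no i; case: (p i).
  rewrite c0 mul0r addr0; apply: hol => i e; have := no i; rewrite e.
  by rewrite eqxx.
have hinf : holomorphic_at (h - \sum_i c (r i 0 - rinf i) * iX) None.
  rewrite /h -sumrB; apply: hol_sum => i _; rewrite /fin /rinf.
  case: (p i) => [a|]; last first.
    by rewrite subrr c0 mul0r mulr0 subr0; apply: holomorphic_at0.
  rewrite subr0.
  have Xa0 : ('X - a%:P)%:F != 0 :> rational_form.
    by rewrite tofrac_eq0 polyXsubC_eq0.
  exists ((r i 0 * a)%:P), (('X - a%:P) * 'X); split.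
    rewrite size_mulX ?polyXsubC_eq0 // size_XsubC.
    by have := size_polyC_leq1 (r i 0 * a); lia.
  rewrite /dlog /c /iX polyCM !tofracM.
  have -> : (a%:P)%:F = 'X%:F - ('X - a%:P)%:F :> rational_form.
    by rewrite -tofracB subKr.
  exact: (frac_aux1 _ X0 Xa0).
have [u [v [hv e]]] :
    holomorphic_at (q%:F + c (\sum_i r i 0) * iX) None.
  have -> : q%:F + c (\sum_i r i 0) * iX = (w + c (\sum_i rinf i) * iX) -
      (h - \sum_i c (r i 0 - rinf i) * iX).
    rewrite -eq -mulr_suml -(big_morph c cD c0) sumrB.
    have -> : c (\sum_i r i 0 - \sum_i rinf i) =
        c (\sum_i r i 0) - c (\sum_i rinf i) by rewrite /c polyCB tofracB.
    exact: frac_aux2.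
  exact: holomorphic_atB.
set S := \sum_i r i 0 in e *.
have v0 : v != 0 by rewrite -size_poly_gt0 (leq_trans _ hv) // addn2.
have X0' : 'X != 0 :> {poly C} by rewrite polyX_eq0.
have eX : (q * 'X + S%:P) * v = u * 'X.
  apply: (frac_eqE X0' v0); rewrite -e tofracD tofracM /c /iX.
  exact: (frac_aux3 _ _ X0).
have [qS|qS] := eqVneq (q * 'X + S%:P) 0.
  by have := congr1 (fun t : {poly C} => t.[0]) qS; rewrite !hornerE ?mulr0 ?add0r.
have := congr1 (fun t : {poly C} => size t) eX; rewrite size_mul //.
have := size_polyMleq u 'X; rewrite size_polyX.
move: qS hv; rewrite -size_poly_gt0.
by move: (size _) (size _) (size _) (size _) => m n k l; lia.
Qed.

Lemma has_residues_perm (s : nat) w (x y : 'cV[C]_s * {ptws 'I_s -> sphere}) :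
  has_residues w x -> has_residues w y ->
  exists t : 'S_s, y = (row_perm t x.1, x.2 \o t).
Proof.
case: x y => [r p] [r' p'] [/= ip pp hp] [/= ip' pp' hp'].
have /choice [f fE] : forall i, exists j, p j = p' i.
  move=> i; apply: contrapT => no; case: (simple_pole_Nholomorphic (pp' i)).
  by apply: hp => j e; apply: no; exists j.
have fi : injective f by move=> i j e; apply: ip'; rewrite -!fE e.
exists (perm fi); congr pair; last by apply: funext => i /=; rewrite permE fE.
apply/matrixP => i j; rewrite mxE permE (ord1 j).
by apply: simple_pole_inj (pp' i) _; rewrite -fE; apply: pp.
Qed.

Lemma has_residues_relabel (s : nat) w (t : 'S_s)
    (x : 'cV[C]_s * {ptws 'I_s -> sphere}) :
  has_residues w x -> has_residues w (row_perm t x.1, x.2 \o t).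
Proof.
case: x => [r p] [/= ip pp hp]; split=> /=.
- by apply: inj_comp ip _; apply: perm_inj.
- by move=> i; rewrite mxE; apply: pp.
- by move=> q hq; apply: hp => i e; apply: (hq (t^-1%g i)); rewrite /= permKV.
Qed.

Lemma Omega1_has_residues (s : nat) w : Omega1_set s w ->
  exists2 x, residue_pole_set s x & has_residues w x.
Proof.
move=> [p [ip /choice [r hr] hp]].
have h : has_residues w (\col_i r i, p : {ptws 'I_s -> sphere}).
  by split=> //= i; rewrite mxE.
exists (\col_i r i, p : {ptws 'I_s -> sphere}) => //.
split=> //; first exact: residue_sum h.
by move=> i /=; rewrite mxE; have [] := hr i.
Qed.

End RationalForms.

Arguments Omega1_set C s : clear implicits.
Arguments residue_pole_set C s : clear implicits.

Section FormSpaces.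
Variables (C : numClosedFieldType) (s : nat).
Local Notation sphere := (sphere C).

Definition relabel (x y : residue_pole_set C s) : bool :=
  `[< exists t : 'S_s,
        val y = (row_perm t (val x).1, (val x).2 \o t) >].

Lemma relabel_refl : reflexive relabel.
Proof.
move=> x; apply/asboolP; exists 1%g; rewrite row_perm1.
by rewrite {1}[val x]surjective_pairing; congr pair; apply: funext => i /=;
  rewrite perm1.
Qed.

Lemma relabel_sym : symmetric relabel.
Proof.
have H x y : relabel x y -> relabel y x.
  move=> /asboolP [t e]; apply/asboolP; exists t^-1%g; rewrite e /=.
  rewrite -row_permM mulVg row_perm1 [LHS]surjective_pairing; congr pair.
  by apply: funext => i /=; rewrite permKV.
by move=> x y; apply/idP/idP; apply: H.
Qed.

Lemma relabel_trans : transitive relabel.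
Proof.
move=> y x z /asboolP [t e] /asboolP [u e']; apply/asboolP; exists (u * t)%g.
rewrite e' e /= row_permM; congr pair.
by apply: funext => i /=; rewrite permM.
Qed.

Canonical relabel_equiv :=
  EquivRel relabel relabel_refl relabel_sym relabel_trans.

(* (H_s x (sphere^s minus the diagonals)) / S(s) *)
Definition residue_classes : topologicalType :=
  quotient_topology {eq_quot relabel_equiv}.

Definition residue_data (w : Omega1_set C s) : residue_pole_set C s :=
  let: exist2 x Px _ := cid2 (Omega1_has_residues (set_valP w)) in
  exist _ x (mem_set Px).

Lemma residue_dataP (w : Omega1_set C s) :
  has_residues (val w) (val (residue_data w)).
Proof. by rewrite /residue_data; case: cid2. Qed.

(* w |-> < r_1, ..., r_s ; p_1, ..., p_s > *)
Definition residue_class (w : Omega1_set C s) : residue_classes :=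
  \pi_{eq_quot relabel_equiv} (residue_data w).

Lemma residue_classP (w : Omega1_set C s) (x : residue_pole_set C s) :
  has_residues (val w) (val x) ->
  residue_class w = \pi_{eq_quot relabel_equiv} x.
Proof.
move=> hx; apply/eqmodP/asboolP.
exact: has_residues_perm (residue_dataP w) hx.
Qed.

(* The topology of Omega^1(-1^s) is the one transported by residue_class. *)
Definition Omega1 : topologicalType := initial_topology residue_class.

Definition form_of (w : Omega1) : {fraction {poly C}} :=
  val (w : Omega1_set C s).

Definition isochronous_set : set Omega1 :=
  [set w | forall p r, simple_pole (form_of w) p r -> 'Re r = 0].

Definition RIOmega1 : topologicalType := isochronous_set.

Definition RIform_of (w : RIOmega1) : {fraction {poly C}} :=
  form_of (val (w : isochronous_set)).

(* T_* w = w', where T_* < r ; p > = < r ; T(p) > *)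
Definition pushforward (T : sphere -> sphere) (w w' : {fraction {poly C}}) :=
  exists2 x : 'cV[C]_s * {ptws 'I_s -> sphere},
    has_residues w x & has_residues w' (x.1, T \o x.2).

Definition PSL2_orbit (w w' : RIOmega1) : bool :=
  `[< exists2 T, @PSL2 C T & pushforward T (RIform_of w) (RIform_of w') >].

Lemma RIform_has_residues (w : RIOmega1) :
  exists x : 'cV[C]_s * {ptws 'I_s -> sphere}, has_residues (RIform_of w) x.
Proof. by eexists; apply: residue_dataP. Qed.

Lemma PSL2_orbit_refl : reflexive PSL2_orbit.
Proof.
move=> w; apply/asboolP; exists id; first exact: PSL2_id.
by have [[r p] h] := RIform_has_residues w; exists (r, p).
Qed.

Lemma PSL2_orbit_sym : symmetric PSL2_orbit.
Proof.
have H w w' : PSL2_orbit w w' -> PSL2_orbit w' w.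
  move=> /asboolP [T /PSL2_inv [U PU [TU UT]] [[r p] h h']].
  apply/asboolP; exists U => //; exists (r, T \o p) => //=.
  have -> // : U \o (T \o p) = p by apply: funext => i /=; rewrite TU.
by move=> w w'; apply/idP/idP; apply: H.
Qed.

Lemma PSL2_orbit_trans : transitive PSL2_orbit.
Proof.
move=> w' w w'' /asboolP [T PT [x h h']] /asboolP [U PU [y k k']].
apply/asboolP; exists (U \o T); first exact: PSL2_comp.
have [t e] := has_residues_perm h' k.
exists (row_perm t x.1, x.2 \o t); first exact: has_residues_relabel.
by move: k'; rewrite e.
Qed.

Canonical PSL2_equiv :=
  EquivRel PSL2_orbit PSL2_orbit_refl PSL2_orbit_sym PSL2_orbit_trans.

Definition RIOmega1_mod_PSL2 : topologicalType :=
  quotient_topology {eq_quot PSL2_equiv}.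

End FormSpaces.

Section Realization.
Variables (C : numClosedFieldType) (s : nat).

Definition A_set : set 'cV[C]_(s.-1) :=
  [set r | \sum_i r i 0 != 0 /\ forall i, r i 0 != 0].

Definition ImA_set : set 'cV[C]_(s.-1) :=
  A_set `&` [set r | forall i, 'Re (r i 0) = 0].

(* The index k : 'I_(s - 3) stands for the coordinate p_(k + 4). *)
Definition config_set : set {ptws 'I_(s - 3) -> C} :=
  [set z : {ptws 'I_(s - 3) -> C} |
     (forall k, z k != 0 /\ z k != 1) /\ injective z].

Definition Im_moduli : topologicalType :=
  (set_type ImA_set * set_type config_set)%type.

Lemma label_subproof (k : 'I_(s - 3)) : (k + 3 < s)%N.
Proof. by rewrite addnC -ltn_subRL. Qed.

(* Labels are 0-based: p_j has the label j - 1 in 'I_s, and the Coxeter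
   generator sigma_j is [tperm i i'] with i = j - 1 and i' = j. *)
Definition label (k : 'I_(s - 3)) : 'I_s := Ordinal (label_subproof k).

(* The representation sigma |-> (A_sigma, f_sigma).  In 'S_s, (t * u)%g is
   the composite "t, then u".  Each f_sigma is a birational map that is regular
   on the configuration space and maps it to itself, and is given here by its
   restriction to it. *)
Record coxeter_rep := CoxeterRep {
  rep_mx : 'S_s -> 'M[int]_(s.-1);
  rep_map : 'S_s -> config_set -> config_set;
  rep_mx1 : rep_mx 1%g = 1%:M;
  rep_mxM : forall t u, rep_mx (t * u)%g = rep_mx u *m rep_mx t;
  rep_map1 : forall z, rep_map 1%g z = z;
  rep_mapM : forall t u z, rep_map (t * u)%g z = rep_map u (rep_map t z);
  (* A_1, ..., A_(s-2) *)
  rep_mx_exchange : forall i i' : 'I_(s.-1), i' = i.+1 :> nat ->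
    rep_mx (tperm (widen_ord (leq_pred s) i) (widen_ord (leq_pred s) i')) =
    xrow i i' 1%:M;
  (* A_(s-1) *)
  rep_mx_last : forall i i' : 'I_s, i' = i.+1 :> nat -> i'.+1 = s ->
    rep_mx (tperm i i') =
    \matrix_(k, l) if k == i :> nat then - 1 else (k == l)%:R;
  (* f_1 *)
  rep_map_1 : forall i i' : 'I_s, i = 0%N :> nat -> i' = 1%N :> nat ->
    forall z k, val (rep_map (tperm i i') z) k = (val z k)^-1;
  (* f_2 *)
  rep_map_2 : forall i i' : 'I_s, i = 1%N :> nat -> i' = 2%N :> nat ->
    forall z k, val (rep_map (tperm i i') z) k = val z k / (val z k - 1);
  (* f_3 *)
  rep_map_3 : forall i i' : 'I_s, i = 2%N :> nat -> i' = 3%N :> nat ->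
    forall z (k0 k : 'I_(s - 3)), k0 = 0%N :> nat ->
    val (rep_map (tperm i i') z) k =
    if k == k0 then (val z k0)^-1 else val z k / val z k0;
  (* f_4, ..., f_(s-1) *)
  rep_map_exchange : forall i i' : 'I_s, i' = i.+1 :> nat -> (2 < i)%N ->
    forall z k l, label l = tperm i i' (label k) ->
    val (rep_map (tperm i i') z) k = val z l }.

Variable rho : coxeter_rep.

Definition Sym_orbit (x y : Im_moduli) : bool :=
  `[< exists t : 'S_s,
        val y.1 = map_mx intr (rep_mx rho t) *m val x.1 /\
        y.2 = rep_map rho t x.2 >].

Lemma Sym_orbit_refl : reflexive Sym_orbit.
Proof.
move=> x; apply/asboolP; exists 1%g.
by rewrite rep_mx1 rep_map1 map_mx1 mul1mx.
Qed.

Lemma Sym_orbit_sym : symmetric Sym_orbit.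
Proof.
have H x y : Sym_orbit x y -> Sym_orbit y x.
  move=> /asboolP [t [e1 e2]]; apply/asboolP; exists t^-1%g.
  rewrite e1 e2 -rep_mapM mulmxA -map_mxM -rep_mxM mulgV rep_mx1 rep_map1.
  by rewrite map_mx1 mul1mx.
by move=> x y; apply/idP/idP; apply: H.
Qed.

Lemma Sym_orbit_trans : transitive Sym_orbit.
Proof.
move=> y x z /asboolP [t [e1 e2]] /asboolP [u [e1' e2']].
apply/asboolP; exists (t * u)%g.
by rewrite e1' e2' e1 e2 rep_mapM rep_mxM map_mxM mulmxA.
Qed.

Canonical Sym_equiv :=
  EquivRel Sym_orbit Sym_orbit_refl Sym_orbit_sym Sym_orbit_trans.

Definition Im_moduli_mod_Sym : topologicalType :=
  quotient_topology {eq_quot Sym_equiv}.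

End Realization.

(* Main.v *)
Require Import Defs.
From mathcomp Require Import all_boot all_order all_algebra all_fingroup.
From mathcomp Require Import zify ring.
From mathcomp Require Import complex.
From mathcomp Require Import all_classical all_reals all_analysis.

Set Implicit Arguments.
Unset Strict Implicit.
Unset Printing Implicit Defensive.

Import Order.TTheory GRing.Theory Num.Theory.
Import numFieldNormedType.Exports.

Local Open Scope classical_set_scope.
Local Open Scope ring_scope.
Local Open Scope quotient_scope.

(** Three points of the sphere can be moved to 0, infinity and 1 by exactly one
    Moebius map, and the images of the remaining poles are then their
    cross-ratios with the first three.  So a labelled form
    < r_1, ..., r_s ; p_1, ..., p_s > has, modulo PSL(2,C), the coordinates
    (r_1, ..., r_(s-1)) and (cross-ratios of p_4, ..., p_s): the last residue is
    recovered because the residues add up to 0.  Forms carry no labelling, so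
    two points of the coordinate space represent the same orbit exactly when
    they come from labellings of one form that differ by a permutation.

    The action of S(s) on coordinates is therefore: put the poles in the standard
    position 0, infinity, 1, z_4, ..., z_s, permute the labels, and read off the
    coordinates again.  Because cross-ratios are invariant under Moebius maps
    this composes correctly ([relabel_config_cross_ratios], [residue_mxM]), and on the
    generators it is given by the prescribed matrices and birational maps
    ([standard_rep]).  Adjacent transpositions generate S(s), so every
    representation with these values is this one ([coxeter_repE]).

    The two maps between the quotients are induced by
    - [form_of_moduli], sending coordinates to the form with poles in standard
      position, which exists by an explicit sum of simple fractions
      ([residue_form_has_residues]) and depends continuously on the coordinates
      because the labelled residues and poles do;
    - [moduli_of], reading the coordinates of some labelling of a form.
    They are mutually inverse up to the two equivalence relations
    ([moduli_ofK], [form_of_moduliK]).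

    Continuity of the second map is the analytic part.  The cross-ratio has to be
    continuous also where a pole is at infinity: composing with z |-> 1/(z - a),
    where a is not a pole, makes all poles finite ([cross_ratio_inv_sub]), and
    that map is continuous at infinity because bounded subsets of the complex
    plane are relatively compact ([bounded_sub_compact], [inv_sub_cvg]).
    Passing to the quotient by relabelling is compatible with restricting to
    imaginary residues because this condition is closed: the preimage of an
    open set of coordinates, enlarged by all labelled data whose residues are not
    imaginary, is open and invariant under relabelling ([coordinates_open]). *)

(** * Cross-ratios on the Riemann sphere *)

Section CrossRatio.
Variable C : numClosedFieldType.
Local Notation sphere := (sphere C).
Implicit Types (p q a b c d : sphere) (M : 'M[C]_2).

(** Homogeneous coordinates: they treat infinity like any other point. *)
Definition homog p : C * C := if p is Some z then (z, 1) else (1, 0).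

Definition bracket p q : C :=
  (homog p).1 * (homog q).2 - (homog p).2 * (homog q).1.

Lemma bracketE (x y : C) : bracket (Some x) (Some y) = x - y.
Proof. by rewrite /bracket /= mulr1 mul1r. Qed.

Lemma bracket_eq0 p q : (bracket p q == 0) = (p == q).
Proof.
rewrite /bracket; case: p q => [x|] [y|] /=.
- by rewrite mulr1 mul1r subr_eq0.
- by rewrite mulr0 sub0r mulr1 oppr_eq0 oner_eq0.
- by rewrite mulr1 mul0r subr0 oner_eq0.
- by rewrite mulr0 mul0r subrr !eqxx.
Qed.

Lemma bracket_neq0 p q : p <> q -> bracket p q != 0.
Proof. by move=> /eqP; rewrite bracket_eq0. Qed.

(** A Moebius map acts on homogeneous coordinates as its matrix, up to a nonzero
    factor at each point; the determinant of two vectors therefore only picks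
    up these factors and the determinant of the matrix. *)
Lemma bracket_moebius M : \det M != 0 ->
  exists2 l : sphere -> C, forall p, l p != 0 &
    forall p q, bracket (moebius M p) (moebius M q) =
                \det M * (l p * l q) * bracket p q.
Proof.
rewrite det_mx2.
pose u p := M 0 0 * (homog p).1 + M 0 1 * (homog p).2.
pose v p := M 1 0 * (homog p).1 + M 1 1 * (homog p).2.
move=> dM.
have uv p : v p = 0 -> u p != 0.
  move=> vp0; apply: contraNneq dM => up0; apply/eqP.
  have h1 : (M 0 0 * M 1 1 - M 0 1 * M 1 0) * (homog p).1 = 0.
    transitivity (u p * M 1 1 - v p * M 0 1); first by rewrite /u /v; ring.
    by rewrite up0 vp0 !mul0r subrr.
  have h2 : (M 0 0 * M 1 1 - M 0 1 * M 1 0) * (homog p).2 = 0.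
    transitivity (v p * M 0 0 - u p * M 1 0); first by rewrite /u /v; ring.
    by rewrite up0 vp0 !mul0r subrr.
  by case: p h1 h2 {up0 vp0} => [z|] /=; rewrite !mulr1.
pose l p := if v p == 0 then (u p)^-1 else (v p)^-1.
have hom p : homog (moebius M p) = (l p * u p, l p * v p).
  case: p => [z|]; rewrite /moebius /l.
    have -> : M 1 0 * z + M 1 1 = v (Some z) by rewrite /v /= mulr1.
    have -> : M 0 0 * z + M 0 1 = u (Some z) by rewrite /u /= mulr1.
    case: eqVneq => [v0|v0] /=; first by rewrite v0 mulVf ?mulr0 ?uv.
    by rewrite mulVf // mulrC.
  have -> : M 1 0 = v None by rewrite /v /= mulr1 mulr0 addr0.
  have -> : M 0 0 = u None by rewrite /u /= mulr1 mulr0 addr0.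
  case: eqVneq => [v0|v0] /=; first by rewrite v0 mulVf ?mulr0 ?uv.
  by rewrite mulVf // mulrC.
exists l => [p|p q].
  by rewrite /l; case: (eqVneq (v p)) => e; rewrite invr_eq0 ?uv.
by rewrite /bracket !hom /= /u /v; ring.
Qed.

(** The value at [d] of the Moebius map that sends [a], [b], [c] to 0, infinity
    and 1. *)
Definition cross_ratio a b c d : C :=
  bracket d a * bracket c b / (bracket d b * bracket c a).

(** Numerator and denominator contain each point equally often, so the factors
    of [bracket_moebius] cancel. *)
Lemma cross_ratio_moebius M a b c d : \det M != 0 ->
  cross_ratio (moebius M a) (moebius M b) (moebius M c) (moebius M d) =
  cross_ratio a b c d.
Proof.
move=> dM; have [l l0 E] := bracket_moebius dM; rewrite /cross_ratio !E.
have [->|db] := eqVneq (bracket d b) 0; first by rewrite !(mulr0, mul0r) invr0 !mulr0.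
have [->|ca] := eqVneq (bracket c a) 0; first by rewrite !(mulr0, mul0r) invr0 !mulr0.
by field; rewrite dM !l0 db ca.
Qed.

Lemma cross_ratio_eq0 a b c d : c <> b -> d <> b -> c <> a ->
  (cross_ratio a b c d == 0) = (d == a).
Proof.
move=> /bracket_neq0 cb /bracket_neq0 db /bracket_neq0 ca.
by rewrite /cross_ratio !(mulf_eq0, invr_eq0) (negbTE cb) (negbTE db) (negbTE ca) !orbF
  bracket_eq0.
Qed.

Lemma cross_ratio1 a b c : c <> b -> c <> a -> cross_ratio a b c c = 1.
Proof.
move=> /bracket_neq0 cb /bracket_neq0 ca.
by rewrite /cross_ratio; field; rewrite cb ca.
Qed.

(** The numerator and the denominator of the cross-ratio are linear in the
    homogeneous coordinates of its last argument, which gives the matrix; it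
    is rescaled by a square root to have determinant 1. *)
Lemma normalizing_moebius a b c : a <> b -> c <> b -> c <> a ->
  exists M, [/\ \det M = 1, moebius M b = None &
    forall d, d <> b -> moebius M d = Some (cross_ratio a b c d)].
Proof.
move=> /bracket_neq0 ab /bracket_neq0 cb /bracket_neq0 ca.
(* [M] below has determinant [k ^+ 2 * D]. *)
pose D := bracket c b * bracket c a * bracket a b.
have D0 : D != 0 by rewrite !mulf_neq0.
pose k := (sqrtC D)^-1.
have kk : k * k * D = 1.
  by rewrite -{1}[D]sqrtCK /k; field; rewrite sqrtC_eq0.
have k0 : k != 0 by rewrite invr_eq0 sqrtC_eq0.
pose M : 'M[C]_2 := \matrix_(i, j)
  if i == 0 then if j == 0 then k * bracket c b * (homog a).2
                 else - (k * bracket c b * (homog a).1)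
  else if j == 0 then k * bracket c a * (homog b).2
       else - (k * bracket c a * (homog b).1).
have M00 : M 0 0 = k * bracket c b * (homog a).2 by rewrite mxE.
have M01 : M 0 1 = - (k * bracket c b * (homog a).1) by rewrite mxE.
have M10 : M 1 0 = k * bracket c a * (homog b).2 by rewrite mxE.
have M11 : M 1 1 = - (k * bracket c a * (homog b).1) by rewrite mxE.
have mob d : moebius M d = if bracket d b == 0 then None
                           else Some (cross_ratio a b c d).
  case: d => [z|] /=.
    have -> : M 1 0 * z + M 1 1 = k * bracket c a * bracket (Some z) b.
      by rewrite M10 M11 /(bracket (Some z)) /=; ring.
    have -> : M 0 0 * z + M 0 1 = k * bracket c b * bracket (Some z) a.
      by rewrite M00 M01 /(bracket (Some z)) /=; ring.
    rewrite !mulf_eq0 (negbTE k0) (negbTE ca) /=; case: eqVneq => // db.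
    by congr Some; rewrite /cross_ratio; field; rewrite k0 ca db.
  have -> : M 1 0 = k * bracket c a * bracket None b.
    by rewrite M10 /(bracket None) /=; ring.
  have -> : M 0 0 = k * bracket c b * bracket None a.
    by rewrite M00 /(bracket None) /=; ring.
  rewrite !mulf_eq0 (negbTE k0) (negbTE ca) /=; case: eqVneq => // db.
  by congr Some; rewrite /cross_ratio; field; rewrite k0 ca db.
exists M; split; last by move=> d /bracket_neq0 db; rewrite mob (negbTE db).
  rewrite det_mx2 M00 M01 M10 M11 -[RHS]kk /D /(bracket a b); ring.
by rewrite mob bracket_eq0 eqxx.
Qed.

End CrossRatio.

(** * Pole tuples in standard position *)

Section Labels.
Variables (C : numClosedFieldType) (n : nat).
Local Notation sphere := (sphere C).
Implicit Types (p : 'I_n.+4 -> sphere) (z : 'I_(n.+4 - 3) -> C).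

Definition lbl0 : 'I_n.+4 := ord0.
Definition lbl1 : 'I_n.+4 := @Ordinal n.+4 1 isT.
Definition lbl2 : 'I_n.+4 := @Ordinal n.+4 2 isT.

Lemma lbl01 : lbl0 <> lbl1. Proof. by move/(congr1 val). Qed.
Lemma lbl20 : lbl2 <> lbl0. Proof. by move/(congr1 val). Qed.
Lemma lbl21 : lbl2 <> lbl1. Proof. by move/(congr1 val). Qed.

Lemma label_neq k (i : 'I_n.+4) : (i < 3)%N -> label k <> i.
Proof. by move=> + /(congr1 val) /= e; rewrite -e; lia. Qed.

Variant label_spec : 'I_n.+4 -> Prop :=
| Label0 : label_spec lbl0
| Label1 : label_spec lbl1
| Label2 : label_spec lbl2
| Label3 k : label_spec (label k).

Lemma labelP i : label_spec i.
Proof.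
case: i => -[|[|[|i]]] lt_i.
- by rewrite (_ : Ordinal _ = lbl0); [constructor|apply: val_inj].
- by rewrite (_ : Ordinal _ = lbl1); [constructor|apply: val_inj].
- by rewrite (_ : Ordinal _ = lbl2); [constructor|apply: val_inj].
have lt_i' : (i < n.+4 - 3)%N by rewrite ltn_subRL addnC addn3.
rewrite (_ : Ordinal _ = label (Ordinal lt_i')); first by constructor.
by apply: val_inj; rewrite /= addn3.
Qed.

Lemma label_inj : injective (@label n.+4).
Proof. by move=> k l /(congr1 val) /= /addIn e; apply: val_inj. Qed.

Definition std_poles z (i : 'I_n.+4) : sphere :=
  match val i with
  | 0%N => Some 0
  | 1%N => None
  | 2%N => Some 1
  | k.+3 => Some (z (@inord n k))
  end.

Lemma std_poles_label z k : std_poles z (label k) = Some (z k).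
Proof.
by rewrite /std_poles /= addn3; congr (Some (z _)); apply: val_inj; rewrite /= inordK.
Qed.

Definition cross_ratios p (k : 'I_(n.+4 - 3)) : C :=
  cross_ratio (p lbl0) (p lbl1) (p lbl2) (p (label k)).

Lemma std_poles_inj z : config_set z -> injective (std_poles z).
Proof.
move=> [z01 zI] i j.
case: (labelP i) => [|||k]; case: (labelP j) => [|||l];
  rewrite ?std_poles_label //= /std_poles /= => -[] // e.
- by have := oner_eq0 C; rewrite -e eqxx.
- by have := (z01 l).1; rewrite -e eqxx.
- by have := oner_eq0 C; rewrite e eqxx.
- by have := (z01 l).2; rewrite -e eqxx.
- by have := (z01 k).1; rewrite e eqxx.
- by have := (z01 k).2; rewrite e eqxx.
- by rewrite (zI _ _ e).
Qed.

(** Distinct poles have distinct images under the normalizing map, and three of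
    these images are 0, infinity and 1. *)
Lemma config_cross_ratios p : injective p -> config_set (cross_ratios p).
Proof.
move=> pI; have ne i j : i <> j -> p i <> p j by move=> ij /pI.
have [M [dM _ E]] := @normalizing_moebius C (p lbl0) (p lbl1) (p lbl2)
  (ne _ _ lbl01) (ne _ _ lbl21) (ne _ _ lbl20).
have dM0 : \det M != 0 by rewrite dM oner_neq0.
have [l l0 B] := bracket_moebius dM0.
have MI : injective (moebius M).
  move=> x y /eqP; rewrite -bracket_eq0 B !mulf_eq0 (negbTE dM0) !(negbTE (l0 _)) /=.
  by rewrite bracket_eq0 => /eqP.
have p21 := ne _ _ lbl21; have p20 := ne _ _ lbl20.
have pk k (i : 'I_n.+4) (i3 : (i < 3)%N) : p (label k) <> p i by apply/ne/label_neq.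
split=> [k|k k' e].
  split; first by rewrite /cross_ratios cross_ratio_eq0 //; [apply/eqP|]; apply: pk.
  rewrite -(cross_ratio1 p21 p20); apply/eqP => e.
  by case: (pk k lbl2) => //; apply: MI; rewrite !E //; [congr Some|apply: pk].
by apply/label_inj/pI/MI; rewrite !E; [congr Some|apply: pk..].
Qed.

Lemma PSL2_std_poles p : injective p ->
  exists2 T, PSL2 T & T \o p = std_poles (cross_ratios p).
Proof.
move=> pI; have ne i j : i <> j -> p i <> p j by move=> ij /pI.
have [M [dM M1 E]] := @normalizing_moebius C (p lbl0) (p lbl1) (p lbl2)
  (ne _ _ lbl01) (ne _ _ lbl21) (ne _ _ lbl20).
exists (moebius M); first by exists M.
apply: funext => i /=; case: (eqVneq i lbl1) => [->|/eqP i1]; first by rewrite M1.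
rewrite E; last exact: ne.
case: (labelP i) i1 => // [_|_|k _]; rewrite ?std_poles_label //; congr Some.
  by apply/eqP; rewrite cross_ratio_eq0 //; apply: ne.
by rewrite cross_ratio1 //; apply: ne.
Qed.

Lemma cross_ratios_std_poles z : cross_ratios (std_poles z) = z.
Proof.
apply: funext => k.
rewrite /cross_ratios std_poles_label /cross_ratio !bracketE /bracket /=.
by field.
Qed.

Lemma cross_ratios_PSL2 T p : PSL2 T -> cross_ratios (T \o p) = cross_ratios p.
Proof.
move=> [M dM ->]; apply: funext => k; rewrite /cross_ratios /=.
by rewrite cross_ratio_moebius ?dM ?oner_neq0.
Qed.

Definition relabel_config (t : 'S_n.+4) z := cross_ratios (std_poles z \o t^-1%g).

(** Normalizing before relabelling changes the poles by a Moebius map only, which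
    the cross-ratios do not see.  This is what makes relabelling in standard
    position an action. *)
Lemma relabel_config_cross_ratios t p : injective p ->
  relabel_config t (cross_ratios p) = cross_ratios (p \o t^-1%g).
Proof.
move=> pI; have [T PT e] := PSL2_std_poles pI.
by rewrite /relabel_config -e -[_ \o _ \o _]/(T \o (p \o t^-1%g)) cross_ratios_PSL2.
Qed.

End Labels.

(** * The linear action on residues *)

Section Residues.
Variable n : nat.

(** The map that completes s - 1 residues by minus their sum. *)
Definition sum0_mx (R : nzRingType) : 'M[R]_(n.+4, n.+3) :=
  \matrix_(i, l) if unlift ord_max i is Some k then (k == l)%:R else -1.

Definition init_rows (R : Type) m (X : 'M[R]_(n.+4, m)) : 'M[R]_(n.+3, m) :=
  rowsub (lift ord_max) X.

Lemma sum0_mx_lift (R : nzRingType) k l :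
  sum0_mx R (lift ord_max k) l = (k == l)%:R.
Proof. by rewrite mxE liftK. Qed.

Lemma sum0_mx_max (R : nzRingType) l : sum0_mx R ord_max l = -1.
Proof. by rewrite mxE unlift_none. Qed.

Lemma sum0_mx_rows (R : nzRingType) m (X : 'M[R]_(n.+3, m)) :
  init_rows (sum0_mx R *m X) = X.
Proof.
apply/matrixP => k j; rewrite !mxE (bigD1 k) //= big1 ?addr0 => [|l lk].
  by rewrite sum0_mx_lift eqxx mul1r.
by rewrite sum0_mx_lift eq_sym (negbTE lk) mul0r.
Qed.

Lemma sum0_mx_last (R : nzRingType) m (X : 'M[R]_(n.+3, m)) j :
  (sum0_mx R *m X) ord_max j = - \sum_k X k j.
Proof.
by rewrite mxE -sumrN; apply: eq_bigr => k _; rewrite sum0_mx_max mulN1r.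
Qed.

Lemma sum_lift (R : nzRingType) (F : 'I_n.+4 -> R) :
  \sum_i F i = \sum_k F (lift ord_max k) + F ord_max.
Proof.
rewrite big_ord_recr /=; congr (_ + _); apply: eq_bigr => k _; congr F.
by apply: val_inj; rewrite /= /bump leqNgt ltn_ord.
Qed.

Lemma sum0_mx_sum (R : nzRingType) m (X : 'M[R]_(n.+3, m)) j :
  \sum_i (sum0_mx R *m X) i j = 0.
Proof.
rewrite sum_lift sum0_mx_last -sumrB big1 // => k _.
by rewrite -{2}(sum0_mx_rows X) [init_rows _ _ _]mxE subrr.
Qed.

Lemma init_rowsK (R : nzRingType) m (X : 'M[R]_(n.+4, m)) :
  (forall j, \sum_i X i j = 0) -> sum0_mx R *m init_rows X = X.
Proof.
move=> X0; apply/matrixP => i j; case: (unliftP ord_max i) => [k|] ->.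
  by have /matrixP/(_ k j) := sum0_mx_rows (init_rows X); rewrite !mxE.
rewrite sum0_mx_last; apply/eqP; rewrite eq_sym -addr_eq0; apply/eqP.
by rewrite -[RHS](X0 j) sum_lift addrC; congr (_ + _); apply: eq_bigr => k _; rewrite mxE.
Qed.

Lemma row_perm_sum (R : nzRingType) m (X : 'M[R]_(n.+4, m)) (t : 'S_n.+4) j :
  \sum_i row_perm t X i j = \sum_i X i j.
Proof.
rewrite [RHS](reindex_inj (@perm_inj _ t)).
by apply: eq_bigr => i _; rewrite mxE.
Qed.

(** Complete the residues, permute all s of them, drop the last one. *)
Definition residue_mx (R : nzRingType) (t : 'S_n.+4) : 'M[R]_n.+3 :=
  init_rows (row_perm t^-1 (sum0_mx R)).

Lemma residue_mxE (R : nzRingType) m (t : 'S_n.+4) (X : 'M[R]_(n.+3, m)) :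
  residue_mx R t *m X = init_rows (row_perm t^-1 (sum0_mx R *m X)).
Proof. by rewrite /residue_mx /init_rows mul_rowsub_mx !row_permEsub mul_rowsub_mx. Qed.

Lemma sum0_residue_mx (R : nzRingType) m (t : 'S_n.+4) (X : 'M[R]_(n.+3, m)) :
  sum0_mx R *m (residue_mx R t *m X) = row_perm t^-1 (sum0_mx R *m X).
Proof.
by rewrite residue_mxE init_rowsK // => j; rewrite row_perm_sum sum0_mx_sum.
Qed.

Lemma residue_mx_intr (R : nzRingType) (t : 'S_n.+4) :
  map_mx intr (residue_mx int t) = residue_mx R t.
Proof.
apply/matrixP => k l; rewrite !mxE.
by case: unlift => [m|]; rewrite ?rmorphN ?rmorph1 //; case: eqP.
Qed.

Lemma residue_mx1 (R : nzRingType) : residue_mx R 1 = 1%:M.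
Proof.
by rewrite /residue_mx invg1 row_perm1 -[sum0_mx R]mulmx1 sum0_mx_rows.
Qed.

Lemma residue_mxM (R : nzRingType) (t u : 'S_n.+4) :
  residue_mx R (t * u)%g = residue_mx R u *m residue_mx R t.
Proof.
rewrite -[LHS]mulmx1 -[RHS]mulmx1 -mulmxA [LHS]residue_mxE [RHS]residue_mxE.
by rewrite sum0_residue_mx invMg row_permM.
Qed.

Lemma widen_lift_max (k : 'I_n.+3) :
  widen_ord (leq_pred n.+4) k = lift ord_max k.
Proof. by apply: val_inj; apply/esym/lift_max. Qed.

Lemma residue_mx_exchange (R : nzRingType) (i i' : 'I_n.+3) :
  residue_mx R (tperm (lift ord_max i) (lift ord_max i')) = xrow i i' 1%:M.
Proof.
apply/matrixP => k l; rewrite !mxE tpermV.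
by rewrite -inj_tperm ?liftK //; exact: lift_inj.
Qed.

(** Exchanging the last two residues brings minus the sum of the first s - 1 of
    them to position s - 1. *)
Lemma residue_mx_last (R : nzRingType) (i i' : 'I_n.+4) :
  i' = i.+1 :> nat -> i'.+1 = n.+4 ->
  residue_mx R (tperm i i') =
    \matrix_(k, l) if k == i :> nat then - 1 else (k == l)%:R.
Proof.
move=> ii' i'n; have -> : i' = ord_max by apply: val_inj; case: i'n.
apply/matrixP => k l; rewrite ![in LHS]mxE [RHS]mxE tpermV.
case: tpermP => [e|e|/eqP ne _].
- by rewrite unlift_none -e lift_max eqxx.
- by have := neq_lift ord_max k; rewrite e eqxx.
- by move: ne; rewrite liftK -val_eqE -(lift_max k) => /negbTE ->.
Qed.

End Residues.

(** * The representation of the symmetric group *)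

Section Representation.
Variables (C : numClosedFieldType) (n : nat).

Lemma permuted_std_poles_inj (t : 'S_n.+4) (z : @config_set C n.+4) :
  injective (std_poles (val z) \o t^-1%g).
Proof. by apply: inj_comp perm_inj; apply/std_poles_inj/set_valP. Qed.

Definition sym_config (t : 'S_n.+4) (z : @config_set C n.+4) : @config_set C n.+4 :=
  SigSub (mem_set (config_cross_ratios (@permuted_std_poles_inj t z))).

Lemma sym_configM t u z : sym_config (t * u)%g z = sym_config u (sym_config t z).
Proof.
apply: val_inj; rewrite /= -[RHS]/(relabel_config u _).
rewrite relabel_config_cross_ratios; last exact: permuted_std_poles_inj.
by congr cross_ratios; apply: funext => i /=; rewrite invMg permM.
Qed.

(** Relabelling has the prescribed values on the generators.  For the maps
    this is the computation of the cross-ratios of a permuted standard tuple: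
    for instance 1/z exchanges 0 and infinity and fixes 1. *)
Lemma standard_rep : {rho : coxeter_rep C n.+4 |
  rep_mx rho = @residue_mx n int & rep_map rho = sym_config}.
Proof.
have fixed (i : 'I_n.+4) k : (i < 3)%N -> i != label k.
  by move=> i3; rewrite eq_sym; apply/eqP/label_neq.
have fixedV (i : 'I_n.+4) k : (i < 3)%N -> label k != i.
  by move=> i3; apply/eqP/label_neq.
have z_neq0 (z : @config_set C n.+4) k : sval z k != 0.
  by have [/(_ k) []] := set_valP z.
have z_neq1 (z : @config_set C n.+4) k : sval z k != 1.
  by have [/(_ k) []] := set_valP z.
unshelve eexists.
  unshelve apply: (@CoxeterRep C n.+4 (@residue_mx n int) sym_config).
- exact: residue_mx1.
- exact: residue_mxM.
- move=> z; apply: val_inj; rewrite /= -[RHS]cross_ratios_std_poles; congr cross_ratios.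
  by apply: funext => i /=; rewrite invg1 perm1.
- exact: sym_configM.
- by move=> i i' _; rewrite !widen_lift_max residue_mx_exchange.
- exact: residue_mx_last.
- move=> i i' i0 i1 z k; have -> : i = lbl0 n by apply: val_inj.
  have -> : i' = lbl1 n by apply: val_inj.
  rewrite /= /cross_ratios /= tpermV tpermL tpermR !tpermD
    ?(std_poles_label (sval z)) ?fixed //.
  by rewrite /cross_ratio !bracketE /bracket /=; field; apply: z_neq0.
- move=> i i' i1 i2 z k; have -> : i = lbl1 n by apply: val_inj.
  have -> : i' = lbl2 n by apply: val_inj.
  rewrite /= /cross_ratios /= tpermV tpermL tpermR !tpermD
    ?(std_poles_label (sval z)) ?fixed //.
  rewrite /cross_ratio !bracketE /bracket /=.
  by field; rewrite subr_eq0 z_neq1.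
- move=> i i' i2 i3 z k0 k k00; have -> : i = lbl2 n by apply: val_inj.
  have -> : i' = label k0 by apply: val_inj; rewrite /= k00.
  rewrite /= /cross_ratios /= tpermV tpermL
    !(@tpermD _ _ _ (lbl0 n), @tpermD _ _ _ (lbl1 n)) ?fixedV //.
  have [->|ne] := eqVneq k k0.
    rewrite tpermR (std_poles_label (sval z)) /cross_ratio !bracketE /bracket /=.
    by field; apply: z_neq0.
  have ne' : label k0 != label k by rewrite (inj_eq (@label_inj n)) eq_sym.
  rewrite (tpermD (fixed (lbl2 n) k isT) ne') !(std_poles_label (sval z)).
  by rewrite /cross_ratio !bracketE /bracket /=; field; apply: z_neq0.
- move=> i i' ii' i2 z k l e.
  have big (j : 'I_n.+4) : (j < 3)%N -> tperm i i' j = j.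
    move=> j3; rewrite tpermD //; apply: contraTneq j3 => <-;
      by rewrite -leqNgt ?ii' // ltnW.
  rewrite /= /cross_ratios /= tpermV -e !big // (std_poles_label (sval z)).
  by rewrite /cross_ratio !bracketE /bracket /=; field.
- by [].
- by [].
Qed.

(** Adjacent transpositions generate the symmetric group: conjugating the
    transposition of i and k by that of k and k + 1 replaces k by k + 1. *)
Lemma adjacent_tperm_ind m (P : 'S_m -> Prop) :
  P 1%g -> (forall t u, P t -> P u -> P (t * u)%g) ->
  (forall i j : 'I_m, j = i.+1 :> nat -> P (tperm i j)) -> forall t, P t.
Proof.
move=> P1 PM Padj t.
have Plt d : forall i j : 'I_m, j = (i + d.+1)%N :> nat -> P (tperm i j).
  elim: d => [|d IH] i j ij; first by apply: Padj; rewrite ij addn1.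
  have lt_k : (i + d.+1 < m)%N by apply: leq_ltn_trans (ltn_ord j); rewrite ij; lia.
  pose k := Ordinal lt_k.
  (* [k] is the predecessor of [j]: (i j) is (i k) conjugated by (k j). *)
  have kj : j = k.+1 :> nat by rewrite ij /= addnS.
  have ik : i != k by rewrite -val_eqE /=; lia.
  have ij' : i != j by rewrite -val_eqE /= ij; lia.
  have -> : tperm i j = (tperm k j * (tperm i k * tperm k j))%g.
    have := tpermJ i k (tperm k j); rewrite tpermL tpermD; last 2 first.
    - by rewrite eq_sym.
    - by rewrite eq_sym.
    by move=> <-; rewrite conjgE tpermV.
  by apply/PM/PM; [apply: Padj|apply: IH|apply: Padj].
have Ptperm i j : P (tperm i j).
  case: (ltngtP i j) => ij; last by rewrite (val_inj ij) tperm1.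
    by apply: (Plt (j - i.+1)%N); lia.
  by rewrite tpermC; apply: (Plt (i - j.+1)%N); lia.
have [ts -> _] := prod_tpermP t.
by elim: ts => [|ij ts IH]; rewrite ?big_nil ?big_cons //; apply: PM.
Qed.

Lemma coxeter_rep_unique (rho rho' : coxeter_rep C n.+4) t :
  rep_mx rho t = rep_mx rho' t /\ rep_map rho t =1 rep_map rho' t.
Proof.
elim/adjacent_tperm_ind: t => [|t u [mt ft] [mu fu]|i i' ii'].
- by rewrite !rep_mx1; split=> // z; rewrite !rep_map1.
- by rewrite !rep_mxM mt mu; split=> // z; rewrite !rep_mapM ft fu.
split.
  have [i'n|i'n] := ltnP i' n.+3; last first.
    have e : i'.+1 = n.+4 by apply/eqP; rewrite eqn_leq ltn_ord.
    by rewrite (rep_mx_last rho ii' e) (rep_mx_last rho' ii' e).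
  have i_n : (i < n.+3)%N by rewrite (leq_trans _ i'n) // ii' ltnW.
  have -> : i = widen_ord (leq_pred n.+4) (Ordinal i_n) by apply: val_inj.
  have -> : i' = widen_ord (leq_pred n.+4) (Ordinal i'n) by apply: val_inj.
  by rewrite !rep_mx_exchange.
move=> z; apply/val_inj/funext => k.
case: (ltngtP i 2) => [i2|i2|i2]; last 1 first.
- by rewrite !(@rep_map_3 _ _ _ _ _ _ _ _ (@ord0 n : 'I_(n.+4 - 3))) // ii' i2.
- case: (posnP i) => [i0|i0]; first by rewrite !rep_map_1 // ii' i0.
  have i1 : i = 1%N :> nat by lia.
  by rewrite !rep_map_2 // ii' i1.
have low (j : 'I_n.+4) : (j < 3)%N -> tperm i i' (label k) <> j.
  move=> j3 e; have := @label_neq n k j j3; apply.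
  rewrite -(tpermK i i' (label k)) e tpermD //; apply/eqP => /(congr1 val) /=; lia.
move E: (tperm i i' (label k)) => l; case: (labelP l) E => [e|e|e|l' e].
- by case: (low (lbl0 n)).
- by case: (low (lbl1 n)).
- by case: (low (lbl2 n)).
by rewrite !(@rep_map_exchange _ _ _ _ _ _ _ _ _ l').
Qed.

Lemma coxeter_repE (rho : coxeter_rep C n.+4) t :
  rep_mx rho t = residue_mx int t /\ rep_map rho t =1 sym_config t.
Proof.
by have [rho0 <- <-] := standard_rep; apply: coxeter_rep_unique.
Qed.

End Representation.

(** * Forms with prescribed simple poles *)

Arguments holomorphic_at : simpl never.

Section PrescribedResidues.
Variables (C : numClosedFieldType) (s : nat).
Local Notation sphere := (sphere C).
Local Notation "x %:F" := (@FracField.tofrac {poly C} x).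

Definition finite_dlog (p : sphere) : {fraction {poly C}} :=
  if p is Some a then dlog (Some a) else 0.

(** The simple fractions of the finite poles suffice: a pole at infinity
    appears by itself, with minus the sum of the finite residues as residue. *)
Definition residue_form (r : 'cV[C]_s) (p : 'I_s -> sphere) : {fraction {poly C}} :=
  \sum_i (r i 0)%:P%:F * finite_dlog (p i).

Lemma holomorphic_at_sum (I : finType) (F : I -> {fraction {poly C}})
    (P : pred I) q :
  (forall i, P i -> holomorphic_at (F i) q) ->
  holomorphic_at (\sum_(i | P i) F i) q.
Proof.
move=> H; apply: (big_ind (fun t => holomorphic_at t q)) => //.
  exact: holomorphic_at0.
by move=> t t'; apply: holomorphic_atD.
Qed.

Lemma finite_dlog_holomorphic (r a : C) (p : sphere) :
  p != Some a -> holomorphic_at (r%:P%:F * finite_dlog p) (Some a).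
Proof.
case: p => [b|] ne; last by rewrite mulr0; apply: holomorphic_at0.
exists r%:P, ('X - b%:P); split=> //.
by rewrite !hornerE subr_eq0; apply: contraNneq ne => ->.
Qed.

(** 1/(z - a) - 1/z decays like 1/z^2. *)
Lemma dlog_sub_infinity (r a : C) :
  holomorphic_at (r%:P%:F * (dlog (Some a) + dlog None)) None.
Proof.
have X0 : 'X%:F != 0 :> {fraction {poly C}} by rewrite tofrac_eq0 polyX_eq0.
have Xa0 : ('X - a%:P)%:F != 0 :> {fraction {poly C}}.
  by rewrite tofrac_eq0 polyXsubC_eq0.
exists ((r * a)%:P), (('X - a%:P) * 'X); split.
  rewrite size_mulX ?polyXsubC_eq0 // size_XsubC.
  by have := size_polyC_leq1 (r * a); lia.
rewrite mulrDr mulrN polyCM !tofracM.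
have -> : a%:P%:F = 'X%:F - ('X - a%:P)%:F :> {fraction {poly C}}.
  by rewrite -tofracB subKr.
exact: (frac_aux1 _ X0 Xa0).
Qed.

(** Away from infinity each pole occurs in one summand.  At infinity,
    subtract r_j / z from the summand of each finite pole and apply
    [dlog_sub_infinity]: as the residues have sum 0, this changes the form by its
    polar part at infinity only. *)
Lemma residue_form_has_residues (r : 'cV[C]_s) (p : {ptws 'I_s -> sphere}) :
  residue_pole_set C s (r, p) -> has_residues (residue_form r p) (r, p).
Proof.
move=> [/= r0 rn0 pI].
have sum0 : \sum_i (r i 0)%:P%:F = 0 :> {fraction {poly C}}.
  by rewrite -[RHS]tofrac0 -polyC0 -r0 raddf_sum [RHS]raddf_sum.
have away i q : p i = q -> forall j, j != i -> p j != q.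
  by move=> <- j; apply: contraNneq => /pI ->.
split=> //= [i|q qp].
  split; first exact: rn0.
  case E: (p i) => [a|].
    rewrite /residue_form (bigD1 i) //= E /= addrAC subrr add0r.
    by apply: holomorphic_at_sum => j ji; apply/finite_dlog_holomorphic/(away i).
  have -> : residue_form r p - (r i 0)%:P%:F * dlog None =
      \sum_(j | j != i) (r j 0)%:P%:F * (finite_dlog (p j) + dlog None).
    rewrite /residue_form (bigD1 i) //= E mulr0 add0r -mulNr.
    have -> : - (r i 0)%:P%:F = \sum_(j | j != i) (r j 0)%:P%:F.
      by move: sum0; rewrite (bigD1 i) //= => /eqP;
        rewrite addr_eq0 => /eqP ->; rewrite opprK.
    by rewrite mulr_suml -big_split /=; apply: eq_bigr => j _; rewrite mulrDr.
  apply: holomorphic_at_sum => j /(away i _ E).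
  by case: (p j) => // a _; apply: dlog_sub_infinity.
case: q qp => [a|] qp.
  by apply: holomorphic_at_sum => j _; apply/finite_dlog_holomorphic/eqP.
have -> : residue_form r p =
    \sum_j (r j 0)%:P%:F * (finite_dlog (p j) + dlog None).
  under eq_bigr do rewrite mulrDr.
  by rewrite big_split /= -mulr_suml sum0 mul0r addr0.
apply: holomorphic_at_sum => j _; case: (p j) (qp j) => // a _.
exact: dlog_sub_infinity.
Qed.

Lemma residue_form_Omega1 (x : residue_pole_set C s) :
  Omega1_set C s (residue_form (val x).1 (val x).2).
Proof.
have [pI pole hol] : has_residues (residue_form (val x).1 (val x).2) (val x).
  by case: x => -[r p] /= /set_mem; apply: residue_form_has_residues.
by exists (val x).2; split=> // i; exists ((val x).1 i 0).
Qed.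

Definition form_with (x : residue_pole_set C s) : Omega1 C s :=
  SigSub (mem_set (residue_form_Omega1 x)).

Lemma form_withP (x : residue_pole_set C s) :
  has_residues (form_of (form_with x)) (val x).
Proof.
by case: x => -[r p] /= rp; apply: residue_form_has_residues; apply/set_mem: rp.
Qed.

(** The topology on forms is transported from classes of labelled data, on which
    this map is the quotient projection. *)
Lemma form_with_continuous : continuous form_with.
Proof.
apply: continuous_comp_initial.
have -> : residue_class (C:=C) (s:=s) \o form_with = \pi_(residue_classes C s).
  by apply: funext => x /=; apply: residue_classP; apply: form_withP.
exact: pi_continuous.
Qed.

(** Every pole of the form is one of the listed ones, and a residue at a pole is
    unique. *)
Lemma isochronousP (w : Omega1 C s) (x : 'cV[C]_s * {ptws 'I_s -> sphere}) :
  has_residues (form_of w) x ->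
  isochronous_set w <-> forall i, 'Re (x.1 i 0) = 0.
Proof.
move=> [pI pole hol]; split=> [iso i|re p r pr]; first exact: iso (pole i).
have [[i pi]|np] := pselect (exists i, x.2 i = p).
  have := pole i; rewrite pi => /simple_pole_inj/(_ pr) <-; exact: re.
by case: (simple_pole_Nholomorphic pr); apply: hol => i pi; apply: np; exists i.
Qed.

End PrescribedResidues.

(** * Topology of the sphere near infinity *)

(** The topology of a numeric closed field is attached to the structure, not to
    the underlying type of pairs of reals, hence this name for the structure. *)
Definition complex_field (R : realType) : numClosedFieldType := complex R.

Section ComplexCompact.
Variable R : realType.
Local Notation C := (complex_field R).

Lemma real_complex_continuous : continuous (fun x : R => real_complex R x : C).
Proof.
move=> x U /nbhs_ballP [e /= e0 eU]; apply/nbhs_ballP.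
move: (e0); rewrite ltcE /= => /andP [/eqP Ime Ree].
exists (complex.Re e) => //= y; rewrite /ball /= => xy; apply: eU => /=.
rewrite /ball /= -rmorphB normc_def /= expr0n /= addr0 sqrtr_sqr ltcE /=.
by rewrite Ime eqxx.
Qed.

(** A disc lies in a square, which is the continuous image of a product of two
    compact real intervals. *)
Lemma bounded_sub_compact (M : C) :
  exists2 K : set C, compact K & forall z, `|z| <= M -> K z.
Proof.
pose I : set R := [set` `[- complex.Re M, complex.Re M]].
pose f (p : R * R) : C := real_complex R p.1 + 'i * real_complex R p.2.
exists (f @` (I `*` I)).
  apply: continuous_compact; last by apply: compact_setX; apply: segment_compact.
  apply: continuous_subspaceT => p; apply: cvgD.
    apply: (@continuous_comp _ _ _ fst (fun x : R => real_complex R x : C)).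
      exact: cvg_fst.
    exact: real_complex_continuous.
  apply: cvgM; first exact: cvg_cst.
  apply: (@continuous_comp _ _ _ snd (fun x : R => real_complex R x : C)).
    exact: cvg_snd.
  exact: real_complex_continuous.
move=> [x y]; rewrite normc_def lecE /= => /andP [_ xyM].
exists (x, y); last by rewrite /f /= [RHS]complexE.
have bound (t : R) : t ^+ 2 <= x ^+ 2 + y ^+ 2 -> I t.
  move=> t_le; rewrite /I /= in_itv /= -ler_norml (le_trans _ xyM) //.
  by rewrite -sqrtr_sqr ler_wsqrtr.
by split; apply: bound; rewrite ?lerDl ?lerDr sqr_ge0.
Qed.

End ComplexCompact.

Section SphereTopology.
Variable C : numClosedFieldType.
Local Notation sphere := (sphere C).
Hypothesis bounded_compact :
  forall M : C, exists2 K : set C, compact K & forall z, `|z| <= M -> K z.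

(** z |-> 1/(z - a), which has its only pole at [a]. *)
Definition inv_sub (a : C) (p : sphere) : C :=
  if p is Some z then (z - a)^-1 else 0.

(** The compact subset of the one-point compactification to remove is one that
    contains the disc of radius [M]. *)
Lemma near_infinity (P : set sphere) (M : C) : P None ->
  (forall z, M < `|z| -> P (Some z)) -> M >= 0 -> \forall p \near (None : sphere), P p.
Proof.
move=> Pinf Pbig M0; have [K cK bK] := bounded_compact M.
exists K; first by split=> //; apply: compact_closed cK; apply: norm_hausdorff.
move=> p [[z nKz <-]|->] //; apply: Pbig.
by rewrite real_ltNge ?normr_real ?ger0_real //; apply/negP => /bK.
Qed.

Lemma near_neq (a : C) (p : sphere) : p <> Some a ->
  \forall q \near p, q <> Some a.
Proof.
case: p => [z|] ne; last first.
  by apply: (near_infinity (M := `|a|)) => // z az [e]; move: az; rewrite e ltxx.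
have : \forall y \near z, y != a.
  have cla : closed [set a].
    exact/accessible_closed_set1/hausdorff_accessible/norm_hausdorff.
  apply: filterS (open_nbhs_nbhs (conj (closed_openC cla) _)).
    by move=> y ya; apply/eqP.
  by move=> e; case: ne; rewrite e.
by apply: filterS => y ya [/eqP]; rewrite (negbTE ya).
Qed.

(** At infinity: |1/(z - a)| < e as soon as |z| > |a| + 1/e. *)
Lemma inv_sub_cvg (a : C) (p : sphere) : p <> Some a ->
  inv_sub a @ p --> inv_sub a p.
Proof.
case: p => [z|] ne.
  have {}ne : z - a != 0 by rewrite subr_eq0; apply: contra_notN ne => /eqP ->.
  have h : (fun y : C => y - a) @ z --> z - a.
    exact: (@cvgB C C C (nbhs z) _ id (fun=> a) z a (@cvg_id _ _) (cvg_cst _)).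
  exact: (cvgV ne h).
apply/(@cvgrPdist_lt _ _ _ _ (nbhs_filter (None : sphere)) _ 0) => e e0.
apply: (@near_infinity (fun t => `|0 - inv_sub a t| < e) (`|a| + e^-1));
  rewrite /= ?subrr ?normr0 //.
  move=> z zM; rewrite sub0r normrN normfV.
  have h : e^-1 < `|z - a|.
    by have := lerB_dist z a; apply: lt_le_trans; rewrite ltrBrDl.
  by rewrite invf_plt ?posrE // (lt_trans _ h) // invr_gt0.
by rewrite addr_ge0 // invr_ge0 ltW.
Qed.

End SphereTopology.

(** * Continuity of cross-ratios *)

Section Convergence.
Context {T : Type} {F : set_system T} {FF : Filter F}.

Lemma cvg_ptws (I : eqType) (K : topologicalType) (f : T -> {ptws I -> K})
    (g : {ptws I -> K}) :
  (forall i, (fun x => f x i) @ F --> g i) -> f @ F --> g.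
Proof.
move=> H; apply/cvg_sup => i U [V [[W oW <-] Wg VU]].
by apply: (filterS VU); apply: (H i); apply: open_nbhs_nbhs.
Qed.

Lemma cvg_mx (K : topologicalType) m n (f : T -> 'M[K]_(m, n)) (M : 'M[K]_(m, n)) :
  (forall i j, (fun x => f x i j) @ F --> M i j) -> f @ F --> M.
Proof.
move=> H U [P MP sPU]; apply: (filterS sPU).
suff: \forall x \near F, forall ij : 'I_m * 'I_n, P ij.1 ij.2 (f x ij.1 ij.2).
  by apply: filterS => x h i j; apply: (h (i, j)).
by apply: filter_forall => -[i j]; apply: (H i j).
Qed.

End Convergence.

Section RatiosContinuous.
Variable C : numClosedFieldType.
Local Notation sphere := (sphere C).
Hypothesis bounded_compact :
  forall M : C, exists2 K : set C, compact K & forall z, `|z| <= M -> K z.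

(** Invariance of the cross-ratio under 1/(z - a), which makes the four points
    finite. *)
Lemma cross_ratio_inv_sub (a : C) (p q r t : sphere) :
  [/\ p <> Some a, q <> Some a, r <> Some a & t <> Some a] ->
  cross_ratio p q r t =
  (inv_sub a t - inv_sub a p) * (inv_sub a r - inv_sub a q) /
  ((inv_sub a t - inv_sub a q) * (inv_sub a r - inv_sub a p)).
Proof.
pose M : 'M[C]_2 := \matrix_(i, j) if i == 0 then (j == 1)%:R
                                   else if j == 0 then 1 else - a.
have dM : \det M != 0.
  by rewrite det_mx2 !mxE /= mul0r sub0r mulr1 oppr_eq0 oner_eq0.
have E x : x <> Some a -> moebius M x = Some (inv_sub a x).
  case: x => [z|] ne /=; rewrite !mxE /= ?oner_eq0 ?mul0r // mul1r subr_eq0.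
  case: eqVneq => [e|za]; first by rewrite e in ne.
  by rewrite add0r mul1r.
move=> [/E Ep /E Eq /E Er /E Et].
by rewrite -(cross_ratio_moebius _ _ _ _ dM) Ep Eq Er Et /cross_ratio !bracketE.
Qed.

(** One more than the sum of the absolute values of the finite points avoids all
    of them. *)
Lemma finite_avoid (I : finType) (p : I -> sphere) :
  exists a : C, forall i, p i <> Some a.
Proof.
pose b i : C := if p i is Some z then `|z| else 0.
have b0 i : 0 <= b i by rewrite /b; case: (p i).
exists (1 + \sum_i b i) => i e.
have : b i = 1 + \sum_j b j by rewrite {1}/b e ger0_norm // addr_ge0 ?sumr_ge0.
rewrite (bigD1 i) //= addrCA => /eqP; rewrite -subr_eq0 opprD addrA subrr add0r.
by rewrite oppr_eq0 gt_eqF // ltr_wpDr // sumr_ge0.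
Qed.

(** Near a tuple of distinct poles that avoids [a], the cross-ratios are a
    quotient of differences of the continuous functions 1/(p_i - a), and the
    denominator does not vanish at the tuple. *)
Lemma cross_ratios_continuous n (p0 : {ptws 'I_n.+4 -> sphere}) : injective p0 ->
  (fun p : {ptws 'I_n.+4 -> sphere} => cross_ratios p : {ptws 'I_(n.+4 - 3) -> C}) @ p0
    --> (cross_ratios p0 : {ptws 'I_(n.+4 - 3) -> C}).
Proof.
move=> pI; apply: (@cvg_ptws _ (nbhs p0) _ _ C (fun p => cross_ratios p)
  (cross_ratios p0)) => k.
have [a p0a] := finite_avoid p0.
pose q (i : 'I_n.+4) (p : {ptws 'I_n.+4 -> sphere}) := inv_sub a (p i).
have FF : Filter (nbhs p0) := nbhs_filter p0.
have proj i : (fun p : {ptws 'I_n.+4 -> sphere} => p i) @ p0 --> p0 i.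
  exact: proj_continuous.
have near_a i : \forall p \near p0, p i <> Some a.
  exact: (proj i _ (near_neq bounded_compact (p0a i))).
have q_cvg i : q i @ p0 --> q i p0.
  exact: cvg_comp (proj i) (inv_sub_cvg bounded_compact (p0a i)).
have qB_cvg i j : (q i - q j) @ p0 --> q i p0 - q j p0.
  exact: (cvgB (q_cvg i) (q_cvg j)).
have qB_neq0 i j : i <> j -> q i p0 - q j p0 != 0.
  move=> ij; rewrite subr_eq0; apply: contra_notN ij => /eqP; rewrite /q => e.
  apply: pI; move: e (p0a i) (p0a j); case: (p0 i) (p0 j) => [x|] [y|] //=.
  - by move/invr_inj/addIr => ->.
  - move=> /eqP; rewrite invr_eq0 subr_eq0 => /eqP -> //.
  - by move=> /eqP; rewrite eq_sym invr_eq0 subr_eq0 => /eqP ->.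
set c : {ptws 'I_n.+4 -> sphere} -> C := fun p =>
  (q (label k) - q (lbl0 n)) p * (q (lbl2 n) - q (lbl1 n)) p /
  ((q (label k) - q (lbl1 n)) p * (q (lbl2 n) - q (lbl0 n)) p).
have c_ratio p : (forall i, p i <> Some a) -> c p = cross_ratios p k.
  by move=> pa; rewrite /cross_ratios (@cross_ratio_inv_sub a).
rewrite -(c_ratio p0 p0a).
suff : c @ p0 --> c p0.
  apply: cvg_trans; apply: near_eq_cvg.
  pose P i (p : {ptws 'I_n.+4 -> sphere}) := p i <> Some a.
  have := @filter_forall _ _ P (nbhs p0) FF near_a.
  by apply: filterS => p /c_ratio.
have den0 : (q (label k) p0 - q (lbl1 n) p0) * (q (lbl2 n) p0 - q (lbl0 n) p0) != 0.
  by rewrite mulf_neq0 //; apply: qB_neq0; [apply: label_neq|apply: lbl20].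
have num_cvg := cvgM (FF := FF) (qB_cvg (label k) (lbl0 n)) (qB_cvg (lbl2 n) (lbl1 n)).
have den_cvg := cvgM (FF := FF) (qB_cvg (label k) (lbl1 n)) (qB_cvg (lbl2 n) (lbl0 n)).
exact: (cvgM (FF := FF) num_cvg (cvgV (FF := FF) den0 den_cvg)).
Qed.

End RatiosContinuous.

(** * The two quotients *)

Local Notation qrepr := generic_quotient.repr.

Section Realization.
Variables (C : numClosedFieldType) (n : nat).
Local Notation sphere := (sphere C).
Local Notation s := n.+4.
Hypothesis bounded_compact :
  forall M : C, exists2 K : set C, compact K & forall z, `|z| <= M -> K z.

Local Notation pole_data := ('cV[C]_s * {ptws 'I_s -> sphere})%type.
Implicit Types (x y : pole_data) (m : Im_moduli C s) (w : RIOmega1 C s).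

Definition permute (t : 'S_s) x : pole_data := (row_perm t x.1, x.2 \o t).

(** A relation rather than a function of [x]: a point of the moduli space contains
    proofs that [x] has distinct poles and imaginary nonzero residues. *)
Definition coordinates m x : Prop :=
  val m.1 = init_rows x.1 /\ val m.2 = cross_ratios x.2.

Lemma coordinates_inj m m' x : coordinates m x -> coordinates m' x -> m = m'.
Proof.
case: m m' => [r z] [r' z'] [/= er ez] [/= er' ez'].
congr pair; apply: val_inj.
 exact: etrans er (esym er').
exact: etrans ez (esym ez').
Qed.

Lemma coordinates_exist x : residue_pole_set C s x ->
  (forall i, 'Re (x.1 i 0) = 0) -> exists m, coordinates m x.
Proof.
move=> [r0 rn0 pI] re.
have Ar : @ImA_set C s (init_rows x.1).
  split; last by move=> i; rewrite mxE.
  split; last by move=> i; rewrite mxE.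
  have := rn0 ord_max; apply: contra_neq => e.
  move: r0; rewrite sum_lift.
  have -> : \sum_k x.1 (lift ord_max k) 0 = 0.
    by rewrite -[RHS]e; apply: eq_bigr => k _; rewrite mxE.
  by rewrite add0r.
by exists (SigSub (mem_set Ar), SigSub (mem_set (config_cross_ratios pI))).
Qed.

Lemma coordinates_Re m x : residue_pole_set C s x -> coordinates m x ->
  forall i, 'Re (x.1 i 0) = 0.
Proof.
move=> [r0 _ _] [er _] i; have [_ mRe] := set_valP m.1.
have re k : 'Re (x.1 (lift ord_max k) 0) = 0.
  have <- : val m.1 k 0 = x.1 (lift ord_max k) 0 by rewrite er mxE.
  exact: mRe.
case: (unliftP ord_max i) => [k|] ->; first exact: re.
have := congr1 (fun y : C => 'Re y) r0; rewrite /= sum_lift raddfD raddf0 /= raddf_sum.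
by rewrite big1 ?add0r // => k _; apply: re.
Qed.

Definition standard_data m : pole_data := (sum0_mx n C *m val m.1, std_poles (val m.2)).

Lemma standard_dataP m : residue_pole_set C s (standard_data m).
Proof.
have [[s0 rn0] _] := set_valP m.1.
split=> /=; [exact: sum0_mx_sum|move=> i|exact/std_poles_inj/set_valP].
case: (unliftP ord_max i) => [k|] ->.
  have /matrixP /(_ k 0) := sum0_mx_rows (val m.1); rewrite mxE => ->; exact: rn0.
by rewrite sum0_mx_last oppr_eq0.
Qed.

Lemma standard_dataE m : coordinates m (standard_data m).
Proof. by split; rewrite /= ?sum0_mx_rows ?cross_ratios_std_poles. Qed.

Definition standard_pole_data m : residue_pole_set C s :=
  SigSub (mem_set (standard_dataP m)).

Lemma fst_val_continuous : continuous (fun m => val m.1 : 'cV[C]_(s.-1)).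
Proof.
move=> m; apply: (@continuous_comp _ _ _ fst
    (val : set_type (@ImA_set C s) -> 'cV[C]_(s.-1))); first exact: cvg_fst.
exact: initial_continuous.
Qed.

Lemma snd_val_continuous :
  continuous (fun m => val m.2 : {ptws 'I_(s - 3) -> C}).
Proof.
move=> m; apply: (@continuous_comp _ _ _ snd
    (val : set_type (@config_set C s) -> {ptws 'I_(s - 3) -> C})).
  exact: cvg_snd.
exact: initial_continuous.
Qed.

Lemma standard_pole_data_continuous : continuous standard_pole_data.
Proof.
apply: continuous_comp_initial => m.
have FF : Filter (nbhs m) := nbhs_filter m.
have r_cvg k j : (fun m' : Im_moduli C s => val m'.1 k j) @ m --> val m.1 k j.
  apply: (@continuous_comp _ _ _ (fun m' : Im_moduli C s => val m'.1)
    (fun r : 'cV[C]_(s.-1) => r k j)); last exact: coord_continuous.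
  exact: fst_val_continuous.
have z_cvg k : (fun m' : Im_moduli C s => val m'.2 k) @ m --> val m.2 k.
  apply: (@continuous_comp _ _ _ (fun m' : Im_moduli C s => val m'.2)
    (fun z : {ptws 'I_(s - 3) -> C} => z k)); last exact: proj_continuous.
  exact: snd_val_continuous.
have c1 : (fun m' => sum0_mx n C *m val m'.1) @ m --> sum0_mx n C *m val m.1.
  apply: (@cvg_mx _ _ FF) => i j.
  have E : (fun m' => (sum0_mx n C *m val m'.1) i j) =
      (fun m' : Im_moduli C s => \sum_k sum0_mx n C i k * val m'.1 k j).
    by apply: funext => m'; rewrite mxE.
  rewrite E mxE.
  apply: cvg_big => [|k _]; first exact: add_continuous.
  apply: cvgM; first exact: cvg_cst.
  exact: r_cvg.
have c2 : (fun m' => std_poles (val m'.2) : {ptws 'I_s -> sphere}) @ m -->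
    (std_poles (val m.2) : {ptws 'I_s -> sphere}).
  apply: (@cvg_ptws _ _ FF) => i.
  case: (labelP i) => [|||k]; [exact: cvg_cst..|].
  have E : (fun m' => std_poles (val m'.2) (label k)) =
      (fun m' : Im_moduli C s => Some (val m'.2 k)).
    by apply: funext => m'; rewrite std_poles_label.
  rewrite E std_poles_label; apply: (cvg_comp _ _ (z_cvg k)).
  exact: one_point_compactification_some_continuous.
exact: (cvg_pair c1 c2).
Qed.

Lemma form_isochronous m : isochronous_set (form_with (standard_pole_data m)).
Proof.
apply/(isochronousP (form_withP (standard_pole_data m))).
exact: coordinates_Re (standard_dataP m) (standard_dataE m).
Qed.

Definition form_of_moduli m : RIOmega1 C s :=
  SigSub (mem_set (@form_isochronous m)).

Lemma form_of_moduliP m : has_residues (RIform_of (form_of_moduli m)) (standard_data m).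
Proof. exact: form_withP (standard_pole_data m). Qed.

Lemma form_of_moduli_continuous : continuous form_of_moduli.
Proof.
apply: continuous_comp_initial => m.
apply: (@continuous_comp _ _ _ standard_pole_data (@form_with C s)).
  exact: standard_pole_data_continuous.
exact: form_with_continuous.
Qed.

Definition pole_data_of w : residue_pole_set C s := residue_data (val w).

Lemma pole_data_ofP w : has_residues (RIform_of w) (val (pole_data_of w)).
Proof. exact: residue_dataP. Qed.

Lemma has_residues_Re w x : has_residues (RIform_of w) x ->
  forall i, 'Re (x.1 i 0) = 0.
Proof. by move=> /isochronousP wx; apply/wx/set_valP. Qed.

Lemma has_residues_set w x : has_residues (RIform_of w) x -> residue_pole_set C s x.
Proof.
move=> wx; split; [exact: residue_sum wx|move=> i|by case: wx].
by case: wx => _ /(_ i) [].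
Qed.

Lemma has_residues_coordinates w x : has_residues (RIform_of w) x ->
  exists m, coordinates m x.
Proof.
move=> wx; apply: coordinates_exist (has_residues_set wx) _.
exact: has_residues_Re wx.
Qed.

Definition moduli_of w : Im_moduli C s :=
  projT1 (cid (has_residues_coordinates (pole_data_ofP w))).

Lemma moduli_ofP w : coordinates (moduli_of w) (val (pole_data_of w)).
Proof. by rewrite /moduli_of; case: cid. Qed.

Variable rho : coxeter_rep C s.

Lemma Sym_orbitP m m' : reflect
  (exists t, val m'.1 = residue_mx C t *m val m.1 /\
             val m'.2 = relabel_config t (val m.2))
  (Sym_orbit rho m m').
Proof.
apply: (iffP (asboolP _)) => -[t [e1 e2]]; exists t;
  have [mxE mapE] := coxeter_repE rho t.
  by rewrite e1 e2 mxE mapE residue_mx_intr.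
rewrite e1 mxE residue_mx_intr; split=> //.
by rewrite mapE; apply: val_inj.
Qed.

(** Relabelling acts on coordinates by the representation.  The inverse appears
    because [permute t] moves position [t i] to position [i]. *)
Lemma coordinates_permute m m' x t : residue_pole_set C s x ->
  coordinates m x -> coordinates m' (permute t x) -> Sym_orbit rho m m'.
Proof.
move=> [r0 _ pI] [r1 z1] [r2 z2]; apply/Sym_orbitP; exists t^-1%g.
rewrite r1 r2 z1 z2 residue_mxE init_rowsK; last by move=> j; rewrite (ord1 j).
by rewrite relabel_config_cross_ratios // !invgK.
Qed.

Lemma coordinates_PSL2 m x T : PSL2 T ->
  coordinates m x -> coordinates m (x.1, T \o x.2).
Proof. by move=> PT [r z]; split; rewrite //= cross_ratios_PSL2. Qed.

(** The chosen labelling of the form differs from [x] by a permutation. *)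
Lemma moduli_of_orbit w x m : has_residues (RIform_of w) x ->
  coordinates m x -> Sym_orbit rho m (moduli_of w).
Proof.
move=> wx mx; have [t e] := has_residues_perm wx (pole_data_ofP w).
apply: (coordinates_permute (t := t) (has_residues_set wx) mx).
by rewrite /permute -e; apply: moduli_ofP.
Qed.

Lemma moduli_of_PSL2 w w' : PSL2_orbit w w' ->
  Sym_orbit rho (moduli_of w) (moduli_of w').
Proof.
move=> /asboolP [T PT [x wx w'x]]; have [m mx] := has_residues_coordinates wx.
apply: (Sym_orbit_trans (y := m)).
  by rewrite Sym_orbit_sym; apply: moduli_of_orbit wx mx.
exact: moduli_of_orbit w'x (coordinates_PSL2 PT mx).
Qed.

Lemma form_of_moduliK m : Sym_orbit rho m (moduli_of (form_of_moduli m)).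
Proof. exact: moduli_of_orbit (form_of_moduliP m) (standard_dataE m). Qed.

(** The Moebius map that normalizes the poles pushes the form forward to the one
    in standard position. *)
Lemma coordinates_form m w x : has_residues (RIform_of w) x -> coordinates m x ->
  PSL2_orbit w (form_of_moduli m).
Proof.
move=> wx [mr mz]; have [r0 _ pI] := has_residues_set wx.
have [T PT e] := PSL2_std_poles pI; apply/asboolP; exists T => //; exists x => //.
have := form_of_moduliP m; rewrite /standard_data mr mz init_rowsK ?e //.
by move=> j; rewrite (ord1 j).
Qed.

Lemma moduli_ofK w : PSL2_orbit w (form_of_moduli (moduli_of w)).
Proof. exact: coordinates_form (pole_data_ofP w) (moduli_ofP w). Qed.

Lemma form_of_moduli_Sym m m' : Sym_orbit rho m m' ->
  PSL2_orbit (form_of_moduli m) (form_of_moduli m').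
Proof.
move=> /Sym_orbitP [t [er ez]].
apply: (coordinates_form (has_residues_relabel t^-1%g (form_of_moduliP m))).
by split; rewrite ?er ?ez //= residue_mxE.
Qed.

Definition moduli_class w : Im_moduli_mod_Sym rho :=
  \pi_(Im_moduli_mod_Sym rho) (moduli_of w).

(** Data whose residues are not all imaginary satisfy the condition vacuously, as
    they have no coordinates.  They form an open set; at imaginary data the
    coordinates vary continuously. *)
Lemma coordinates_open (U : set (Im_moduli C s)) : open U ->
  open [set x : residue_pole_set C s | forall m, coordinates m (val x) -> U m].
Proof.
move=> oU; rewrite openE => x0 Wx0.
have FF : Filter (nbhs x0) := nbhs_filter x0.
have x0P : residue_pole_set C s (val x0) by exact: set_valP.
have v_cvg : (val : residue_pole_set C s -> pole_data) @ x0 --> val x0.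
  exact: initial_continuous.
have r_cvg i j : (fun x : residue_pole_set C s => (val x).1 i j) @ x0 --> (val x0).1 i j.
  exact: (cvg_comp _ _ (cvg_comp _ _ v_cvg cvg_fst)
    (@coord_continuous C s 1 i j (val x0).1)).
have [re|/existsNP [i nre]] := pselect (forall i, 'Re ((val x0).1 i 0) = 0).
  have [m mx] := coordinates_exist x0P re.
  have : nbhs m U by apply: open_nbhs_nbhs; split=> //; apply: Wx0.
  move=> [[A B] [/= [A' [[A2 oA <-] mA sA]] [B' [[B2 oB <-] mB sB]]] AB].
  have rows_cvg : (fun x : residue_pole_set C s => init_rows (val x).1) @ x0 -->
      init_rows (val x0).1.
    apply: (@cvg_mx _ _ FF) => k j.
    have E : (fun x : residue_pole_set C s => init_rows (val x).1 k j) =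
        (fun x : residue_pole_set C s => (val x).1 (lift ord_max k) j).
      by apply: funext => x; rewrite mxE.
    by rewrite E mxE; apply: r_cvg.
  have ratios_cvg : (fun x : residue_pole_set C s =>
      cross_ratios (val x).2 : {ptws 'I_(s - 3) -> C}) @ x0 -->
      (cross_ratios (val x0).2 : {ptws 'I_(s - 3) -> C}).
    have pI : injective (val x0).2 by case: x0P.
    exact: (cvg_comp _ _ (cvg_comp _ _ v_cvg cvg_snd)
      (cross_ratios_continuous bounded_compact pI)).
  have nA : \forall x \near x0, A2 (init_rows (val x).1).
    by apply: rows_cvg; apply: open_nbhs_nbhs; split=> //; rewrite -mx.1.
  have nB : \forall x \near x0, B2 (cross_ratios (val x).2).
    by apply: ratios_cvg; apply: open_nbhs_nbhs; split=> //; rewrite -mx.2.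
  apply: filterS (filterI nA nB) => x [Ax Bx] m' [er ez]; apply: AB.
  by split; [exact: (sA _ (eq_ind_r A2 Ax er))|exact: (sB _ (eq_ind_r B2 Bx ez))].
(* As |Re z| <= |z|, a residue with nonzero real part stays off the imaginary
   axis within a distance of that real part. *)
have e0 : 0 < `|'Re ((val x0).1 i 0)| by rewrite normr_gt0; apply/eqP.
have /(@cvgrPdist_lt _ _ _ _ FF)/(_ _ e0) := r_cvg i 0.
apply: filterS => x close m mx.
have xRe : forall j, 'Re ((val x).1 j 0) = 0 := coordinates_Re (set_valP x) mx.
have := le_lt_trans (leif_normC_Re_Creal _) close.
by rewrite raddfB /= xRe subr0 ltxx.
Qed.

(** Coordinates depend on the labelling only up to the action of the symmetric
    group, so the set of [coordinates_open] for an invariant open set is a union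
    of relabelling classes, hence the preimage of an open set of classes. *)
Lemma moduli_class_continuous : continuous moduli_class.
Proof.
apply/continuousP => U oU.
pose V : set (Im_moduli C s) := \pi_(Im_moduli_mod_Sym rho) @^-1` U.
pose W := [set x : residue_pole_set C s | forall m, coordinates m (val x) -> V m].
have oW : open W by apply: coordinates_open.
have VP m m' : Sym_orbit rho m m' -> V m -> V m'.
  by move=> mm'; rewrite /V /=; have /eqmodP -> := mm'.
have satW (x y : residue_pole_set C s) : relabel x y -> W x -> W y.
  move=> /asboolP [t e] Wx m my.
  have xP : residue_pole_set C s (val x) by exact: set_valP.
  have xRe i : 'Re ((val x).1 i 0) = 0.
    have yRe : forall j, 'Re ((val y).1 j 0) = 0 := coordinates_Re (set_valP y) my.
    by have := yRe (t^-1%g i); rewrite e /= mxE permKV.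
  have [m' m'x] := coordinates_exist xP xRe.
  apply: VP (Wx _ m'x).
  by apply: (coordinates_permute (t := t) xP m'x); rewrite /permute -e.
pose WW : set (residue_classes C s) := [set c | W (qrepr c)].
have oWW : open WW.
  rewrite /open /= /quotient_open.
  have -> // : \pi_(residue_classes C s) @^-1` WW = W.
  apply/seteqP; split => x /=.
    by apply: satW; apply/eqmodP; rewrite reprK.
  by apply: satW; apply/eqmodP; rewrite reprK.
have -> : moduli_class @^-1` U =
    (fun w => residue_class (val w)) @^-1` WW.
  apply/seteqP; split => w /= Uw.
    apply: (satW (pole_data_of w)); first by apply/eqmodP; rewrite reprK.
    by move=> m /coordinates_inj/(_ (moduli_ofP w)) ->.
  have /satW : relabel (qrepr (residue_class (val w))) (pole_data_of w).
    by apply/eqmodP; rewrite reprK.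
  by move=> /(_ Uw) /(_ _ (moduli_ofP w)).
apply: (@open_comp _ _ (fun w => residue_class (val w))) => // w _.
apply: (@continuous_comp _ _ _ (val : RIOmega1 C s -> Omega1 C s)
  (@residue_class C s : Omega1 C s -> residue_classes C s));
  exact: initial_continuous.
Qed.

Lemma form_class_continuous :
  continuous (fun m => \pi_(RIOmega1_mod_PSL2 C s) (form_of_moduli m)).
Proof.
move=> m; apply: (@continuous_comp _ _ _ form_of_moduli).
  exact: form_of_moduli_continuous.
exact: pi_continuous.
Qed.

Lemma moduli_homeomorphic :
  homeomorphic (RIOmega1_mod_PSL2 C s) (Im_moduli_mod_Sym rho).
Proof.
have hom1 : {homo moduli_class : w w' /
    \pi_(RIOmega1_mod_PSL2 C s) w == \pi_(RIOmega1_mod_PSL2 C s) w' >-> w == w'}.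
  by move=> w w' /eqP/eqmodP/moduli_of_PSL2 ww'; apply/eqP/eqmodP.
pose g0 m := \pi_(RIOmega1_mod_PSL2 C s) (form_of_moduli m).
have hom2 : {homo g0 : m m' / \pi_(Im_moduli_mod_Sym rho) m ==
    \pi_(Im_moduli_mod_Sym rho) m' >-> m == m'}.
  by move=> m m' /eqP/eqmodP/form_of_moduli_Sym mm'; apply/eqP/eqmodP.
exists (moduli_class \o qrepr), (g0 \o qrepr); split.
- exact: repr_comp_continuous moduli_class_continuous hom1.
- exact: repr_comp_continuous form_class_continuous hom2.
- move=> c /=; rewrite -[RHS]reprK.
  have /hom2/eqP -> : \pi_(Im_moduli_mod_Sym rho) (qrepr (moduli_class (qrepr c))) ==
      \pi_(Im_moduli_mod_Sym rho) (moduli_of (qrepr c)) by rewrite reprK.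
  by apply/esym/eqmodP/moduli_ofK.
- move=> c /=; rewrite -[RHS]reprK.
  have /hom1/eqP -> : \pi_(RIOmega1_mod_PSL2 C s) (qrepr (g0 (qrepr c))) ==
      \pi_(RIOmega1_mod_PSL2 C s) (form_of_moduli (qrepr c)) by rewrite reprK.
  by apply/esym/eqmodP/form_of_moduliK.
Qed.

End Realization.

(* The first conjunct says that the values prescribed on the Coxeter generators
   extend to a representation of S(s); the extension is then unique. *)
Theorem corollary4p6 (R : realType) (s : nat) (hs : (4 <= s)%N) :
  inhabited (coxeter_rep (complex R) s) /\
  forall rho : coxeter_rep (complex R) s,
    homeomorphic (RIOmega1_mod_PSL2 (complex R) s) (Im_moduli_mod_Sym rho).
Proof.
case: s hs => [|[|[|[|n]]]] // _; split.
  by have [rho _ _] := standard_rep (complex R) n; exists.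
exact: moduli_homeomorphic (@bounded_sub_compact R).
Qed.
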